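(* For $i=1,2$, let $l^i:[0,T]\times\mathbb{R}\to\mathbb{R}$ be a deterministic measurable function such that: (1) for each $x$, $t\mapsto l^i(t,x)$ is continuous; (2) $\sup_{t\in[0,T]}|l^i(t,0)|^2<\infty$; (3) for each $t$, $x\mapsto l^i(t,x)$ is strictly increasing, and there are constants $0<c_{l^i}<C_{l^i}$ such that $c_{l^i}|x-y|\le|l^i(t,x)-l^i(t,y)|\le C_{l^i}|x-y|$ for all $t\in[0,T]$ and $x,y\in\mathbb{R}$. Let $a:[0,T]\to\mathbb{R}$ be a deterministic bounded measurable function, let $f^i\in\mathcal{H}^2$, and let $\xi^i\in L^2(\mathcal{F}_T)$ satisfy $\mathsf{E}[l^i(T,\xi^i)]\ge0$, $i=1,2$. Let $(Y^i,Z^i,K^i)\in\mathcal{S}^2\times\mathcal{H}^2\times I[0,T]$ be the solution of the mean reflected BSDE $$\begin{cases}Y^i_t=\xi^i+\int_t^T(a_sY^i_s+f^i_s)ds-\int_t^TZ^i_sdB_s+K^i_T-K^i_t, & t\in[0,T],\\ \mathsf{E}[l^i(t,Y^i_t)]\ge0, & t\in[0,T],\\ K^i\in I[0,T]\ \text{ and }\ \int_0^T\mathsf{E}[l^i(t,Y^i_t)]dK^i_t=0.\end{cases}$$ Suppose that: \begin{itemize} \item $\mathsf{E}[\xi^1]\ge\mathsf{E}[\xi^2]$, and $\mathsf{E}[f^1_t]\ge\mathsf{E}[f^2_t]$ for every $t\in[0,T]$; \item for every $t\in[0,T]$, $l^1(t,\cdot)$ is concave and $l^2(t,\cdot)$ is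 convex; \item for every $(t,x)\in[0,T]\times\mathbb{R}$, $l^1(t,x)\le l^2(t,x)$. \end{itemize} Then $\mathsf{E}[Y^1_t]\ge\mathsf{E}[Y^2_t]$ for every $t\in[0,T]$.
   Context: Let $T>0$, let $(\Omega,\mathcal{F},\mathbb{F}=(\mathcal{F}_t)_{t\in[0,T]},\mathsf{P})$ be a filtered probability space satisfying the usual conditions and carrying a one-dimensional standard Brownian motion $B$, where $\mathbb{F}$ is the augmented filtration generated by $B$. $\mathsf{E}$ denotes (classical) expectation under $\mathsf{P}$. $L^2(\mathcal{F}_T)$ is the set of real $\mathcal{F}_T$-measurable $\xi$ with $\mathsf{E}[|\xi|^2]<\infty$. $\mathcal{S}^2$ is the set of real adapted continuous processes $Y$ on $[0,T]$ with $\mathsf{E}[\sup_{r\in[0,T]}|Y_r|^2]<\infty$. $\mathcal{H}^2$ is the set of real predictable processes $Z$ with $\mathsf{E}[\int_0^T|Z_r|^2dr]<\infty$. $I[0,T]$ is the set of (deterministic) continuous nondecreasing functions $K:[0,T]\to\mathbb{R}$ with $K_0=0$. *)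

(* Defs.v *)
From HB Require Import structures.
From mathcomp Require Import all_boot all_order all_algebra.
From mathcomp Require Import all_classical all_reals all_analysis.

Set Implicit Arguments.
Unset Strict Implicit.
Unset Printing Implicit Defensive.

Import Order.TTheory GRing.Theory Num.Theory.
Import numFieldNormedType.Exports.

Local Open Scope classical_set_scope.
Local Open Scope ring_scope.

(* A process on [0, T] is a function X : R -> Omega -> R (time first); its
   values at times outside [0, T] are never used. *)

Section StochasticBasis.
Context {R : realType} {d : measure_display} {Omega : measurableType d}.
Variables (P : probability Omega R) (T : R) (F : R -> set (set Omega)).
Implicit Types (B X Y Z I : R -> Omega -> R) (xi : Omega -> R).

Definition measurable_wrt (G : set (set Omega)) (xi : Omega -> R) : Prop :=
  forall A : set R, measurable A -> G (xi @^-1` A).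

Definition adapted X : Prop :=
  forall t, t \in `[0, T] -> measurable_wrt (F t) (X t).

Record is_filtration : Prop := {
  filtration_sigma_algebra : forall t, t \in `[0, T] ->
    sigma_algebra setT (F t) ;
  filtration_sub : forall t, t \in `[0, T] -> F t `<=` measurable ;
  filtration_nondecreasing : forall s t, 0 <= s -> s <= t -> t <= T ->
    F s `<=` F t }.

Record usual_conditions : Prop := {
  uc_complete : measure_is_complete P ;
  uc_negligible : P.-negligible `<=` F 0 ;
  uc_right_continuous : forall t, 0 <= t < T ->
    \bigcap_(s in [set` `]t, T]]) F s `<=` F t }.

Definition independent_of (G : set (set Omega)) xi : Prop :=
  forall (A : set Omega) (C : set R), G A -> measurable C ->
    P (A `&` xi @^-1` C) = (P A * P (xi @^-1` C))%E.

Record is_brownian_motion B : Prop := {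
  bm_adapted : adapted B ;
  bm_start : {ae P, forall w, B 0 w = 0} ;
  bm_continuous :
    {ae P, forall w, {within [set` `[0, T]], continuous (fun t => B t w)}} ;
  bm_independent : forall s t, 0 <= s -> s < t -> t <= T ->
    independent_of (F s) (fun w => B t w - B s w) ;
  (* the second parameter of normal_prob is the standard deviation *)
  bm_normal : forall s t, 0 <= s -> s < t -> t <= T ->
    forall A : set R, measurable A ->
      P ((fun w => B t w - B s w) @^-1` A) = normal_prob 0 (Num.sqrt (t - s)) A
}.

Definition augmented_filtration B (t : R) : set (set Omega) :=
  <<s (\bigcup_(s in [set` `[0, t]])
         preimage_set_system setT (B s) (measurable : set (set R)))
      `|` P.-negligible >>.

Definition time_domain : set (R * Omega) := [set` `[0, T]] `*` setT.

Definition predictable_rectangle : set (set (R * Omega)) :=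
  [set C | (exists2 A, F 0 A & C = [set 0] `*` A) \/
           (exists s t A, [/\ 0 <= s, s < t, t <= T, F s A &
                           C = [set` `]s, t]] `*` A])].

Definition predictable X : Prop :=
  forall A : set R, measurable A ->
    <<s time_domain, predictable_rectangle >>
      (time_domain `&` (fun p => X p.1 p.2) @^-1` A).

Definition L2_terminal xi : Prop :=
  measurable_wrt (F T) xi /\ ('E_P[fun w => (`|xi w| ^+ 2)%R] < +oo)%E.

Definition S2_process Y : Prop :=
  [/\ adapted Y,
      {ae P, forall w, {within [set` `[0, T]], continuous (fun t => Y t w)}} &
      (\int[P]_w ereal_sup [set (`|Y r w| ^+ 2)%:E | r in [set` `[0%R, T]]]
         < +oo)%E].

Definition H2norm2 Z : \bar R :=
  (\int[P]_w \int[lebesgue_measure]_(r in [set` `[0%R, T]])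
     (`|Z r w| ^+ 2)%:E)%E.

Definition H2_process Z : Prop := predictable Z /\ (H2norm2 Z < +oo)%E.

(* The process t |-> \sum_(i < n) h_i 1_(u_i, u_(i+1)](t). *)
Record simple_process := SimpleProcess {
  sp_size : nat ;
  sp_time : nat -> R ;
  sp_coef : nat -> Omega -> R ;
  sp_time_ge0 : 0 <= sp_time 0 ;
  sp_time_nondecreasing : forall i, (i < sp_size)%N ->
    sp_time i <= sp_time i.+1 ;
  sp_time_leT : sp_time sp_size <= T ;
  sp_coef_measurable : forall i, (i < sp_size)%N ->
    measurable_wrt (F (sp_time i)) (sp_coef i) ;
  sp_coef_bounded : exists M : R, forall i w, (i < sp_size)%N ->
    `|sp_coef i w| <= M }.

Definition sp_value (H : simple_process) (t : R) (w : Omega) : R :=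
  \sum_(i < sp_size H)
    sp_coef H i w * \1_([set` `]sp_time H i, sp_time H i.+1]]) t.

Definition sp_integral B (H : simple_process) (t : R) (w : Omega) : R :=
  \sum_(i < sp_size H)
    sp_coef H i w * (B (Num.min (sp_time H i.+1) t) w
                     - B (Num.min (sp_time H i) t) w).

(* I is (a version of) the Ito integral process t |-> \int_0^t Z_s dB_s:
   the L^2 limit of the integrals of simple processes converging to Z in
   L^2(P x dt). Thus I t is determined up to a P-null set, for each t. *)
Definition is_ito_integral B Z I : Prop :=
  adapted I /\
  exists H : nat -> simple_process,
    H2norm2 (fun t w => sp_value (H k) t w - Z t w) @[k --> \oo] --> 0%E /\
    forall t, t \in `[0, T] ->
      'E_P[fun w => (`|sp_integral B (H k) t w - I t w| ^+ 2)%R]%E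
        @[k --> \oo] --> 0%E.

End StochasticBasis.

Section Compensator.
Context {R : realType}.

Record I0T (T : R) := MkI0T {
  I0T_fun :> R -> R ;
  I0T_continuous : {within [set` `[0, T]], continuous I0T_fun} ;
  I0T_nondecreasing : {in `[0, T] &, {homo I0T_fun : s t / s <= t}} ;
  I0T_zero : I0T_fun 0 = 0 }.

(* K extended from [0, T] to the whole line by constants. *)
Definition extend_const (T : R) (K : I0T T) (t : R) : R :=
  K (Num.max 0 (Num.min t T)).

Let extend_const_nd T (K : I0T T) : nondecreasing (extend_const K).
Proof.
move=> s t st; rewrite /extend_const.
have [T0|T0] := leP 0 T; last first.
  by rewrite !max_l// ge_min (ltW T0) orbT.
have in0T u : Num.max 0 (Num.min u T) \in `[0, T].
  by rewrite in_itv/= le_max lexx/= ge_max T0 ge_min lexx orbT.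
apply: I0T_nondecreasing => //.
by rewrite ge_max !le_max lexx /= le_min !ge_min st lexx !orbT.
Qed.

Let extend_const_rc T (K : I0T T) : right_continuous (extend_const K).
Proof.
have [T0|T0] := leP 0 T; last first.
  have -> : extend_const K = cst (K 0).
    by apply/funext => t; rewrite /extend_const max_l// ge_min (ltW T0) orbT.
  by move=> x; exact: cvg_cst.
apply: right_continuousW => x.
have in0T u : [set` `[0, T]] (Num.max 0 (Num.min u T)).
  by rewrite /= in_itv/= le_max lexx/= ge_max T0 ge_min lexx orbT.
have cc : continuous (fun u : R => Num.max 0 (Num.min u T)).
  move=> u; apply: (@continuous_max _ _ (cst 0) (fun v => Num.min v T)).
    exact: cvg_cst.
  by apply: (@continuous_min _ _ id (cst T)); [exact: cvg_id|exact: cvg_cst].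
have /subspace_continuousP cK := @I0T_continuous T K.
move=> U KU; have := cc x _ (cK _ (in0T x) _ KU).
by apply: (@filterS _ (nbhs x)) => y /(_ (in0T y)).
Qed.

HB.instance Definition _ T (K : I0T T) :=
  isCumulative.Build R _ R (extend_const K)
    (@extend_const_nd T K) (@extend_const_rc T K).

End Compensator.

Section MeanReflectedBSDE.
Context {R : realType} {d : measure_display} {Omega : measurableType d}.
Local Notation mu := lebesgue_measure.

Record is_loss_function (T : R) (l : R -> R -> R) : Prop := {
  loss_measurable :
    measurable_fun ([set` `[0, T]] `*` setT) (fun p : R * R => l p.1 p.2) ;
  loss_continuous : forall x,
    {within [set` `[0, T]], continuous (fun t => l t x)} ;
  loss_bounded0 : has_ubound [set `|l t 0| ^+ 2 | t in [set` `[0, T]]] ;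
  loss_increasing : forall t, t \in `[0, T] -> {homo l t : x y / x < y} ;
  loss_bilipschitz : exists c C : R, [/\ 0 < c, c < C &
    forall t x y, t \in `[0, T] ->
      c * `|x - y| <= `|l t x - l t y| <= C * `|x - y|] }.

(* convex_function is stated in the library for maps between left modules. *)
Definition convex (f : R -> R) : Prop :=
  convex_function (setT : set (convex_lmodType R^o)) f.

Definition concave (f : R -> R) : Prop := convex (fun x => - f x).

Record mean_reflected_solution (P : probability Omega R) (T : R)
    (F : R -> set (set Omega)) (B : R -> Omega -> R) (l : R -> R -> R)
    (a : R -> R) (f : R -> Omega -> R) (xi : Omega -> R)
    (Y Z : R -> Omega -> R) (K : I0T T) : Prop := {
  sol_Y : S2_process P T F Y ;
  sol_Z : H2_process P T F Z ;
  sol_equation : exists2 I, is_ito_integral P T F B Z I &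
    forall t, t \in `[0, T] -> {ae P, forall w,
      Y t w = xi w + \int[mu]_(s in [set` `[t, T]]) (a s * Y s w + f s w)
              - (I T w - I t w) + (K T - K t)} ;
  sol_constraint : forall t, t \in `[0, T] ->
    (0 <= 'E_P[fun w => l t (Y t w)])%E ;
  sol_skorokhod :
    (\int[lebesgue_stieltjes_measure (extend_const K)]_(t in [set` `[0%R, T]])
       'E_P[fun w => l t (Y t w)] = 0)%E }.

End MeanReflectedBSDE.

(* Main.v *)
Require Import Defs.
From HB Require Import structures.
From mathcomp Require Import all_boot all_order all_algebra.
From mathcomp Require Import all_classical all_reals all_analysis.
From mathcomp Require Import measurable_realfun ring lra.

Set Implicit Arguments.
Unset Strict Implicit.
Unset Printing Implicit Defensive.

Import Order.TTheory GRing.Theory Num.Theory.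
Import numFieldNormedType.Exports.

Local Open Scope classical_set_scope.
Local Open Scope ring_scope.

(** Taking expectations in the backward equation kills the stochastic integral
    and leaves an equation between deterministic functions,
      E Y_t = E xi + int_t^T (a_s E Y_s + E f_s) ds + K_T - K_t
    ([mean_equation]). The claim is then a comparison of the two continuous
    functions E Y^1 and E Y^2. As long as D := E Y^2 - E Y^1 is positive, the
    constraint on Y^2 is slack: Jensen's inequality for the convex l^2 and the
    concave l^1 gives
      E l^2(t, Y^2_t) >= l^2(t, E Y^2_t) > l^2(t, E Y^1_t)
                      >= l^1(t, E Y^1_t) >= E l^1(t, Y^1_t) >= 0
    ([constraint_slack]), so by the Skorokhod condition K^2 does not move
    ([skorokhod_flat]), whereas K^1 can only push E Y^1 up. Hence, going backward
    in time, D grows at most like the solution of a linear equation with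
    coefficient |a|; since D_T <= 0 it never becomes positive
    ([backward_comparison], a Gronwall argument without exponentials).

    The probabilistic content is that the Ito integral has mean zero. For a simple
    process this reduces to E[h (B_t - B_s)] = 0 with h bounded and F_s-measurable;
    for h the indicator of A in F_s the product has a symmetric law, because the
    increment is independent of A and its normal law is symmetric
    ([centered_indicator_mul]), and h is a uniform limit of combinations of such
    indicators. Uniform limits and the L^2 limits defining the Ito integral are both
    instances of closure of mean-zero variables under L^1 approximation
    ([centered_approx]).

    Exchanging expectation and time integral requires joint measurability in
    (t, w): predictable processes have it, and Y has it up to a null set because its
    paths are continuous ([caratheodory_measurable]). *)

(** * Integration on time and on the product space *)

(** The integral of a nonnegative function is a supremum over the simple
    functions below it, so it is monotone even for non-measurable functions. This
    matters for the supremum of the paths in the S^2 norm and for the integrand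
    of the Skorokhod condition, neither of which is known to be measurable. *)
Lemma ge0_le_lower_integral d (U : measurableType d) (R : realType)
    (mu : {measure set U -> \bar R}) (D : set U) (f g : U -> \bar R) :
  (forall x, D x -> 0 <= f x)%E -> (forall x, D x -> f x <= g x)%E ->
  (\int[mu]_(x in D) f x <= \int[mu]_(x in D) g x)%E.
Proof.
move=> f0 fg; rewrite !ge0_integralE//; last first.
  by move=> x Dx; exact: le_trans (f0 _ Dx) (fg _ Dx).
apply: ereal_sup_le => _ [h hf <-]; exists h => // x.
by apply: le_trans (hf x) _; rewrite /patch; case: ifPn => // /set_mem /fg.
Qed.

Lemma sqr_integrable d (Omega : measurableType d) (R : realType)
    (P : probability Omega R) (X : Omega -> R) :
  measurable_fun setT X -> (\int[P]_w (`|X w| ^+ 2)%:E < +oo)%E ->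
  P.-integrable setT (EFin \o X).
Proof.
move=> mX X2; have mX2 : measurable_fun setT (fun w => `|X w| ^+ 2).
  by apply: measurable_funX; exact: measurableT_comp.
have i1 : P.-integrable setT (EFin \o cst 1).
  by apply: finite_measure_integrable_cst.
have i2 : P.-integrable setT (EFin \o (fun w => `|X w| ^+ 2)).
  apply/integrableP; split; first exact/measurable_EFinP.
  by under eq_integral do rewrite /= ger0_norm ?exprn_ge0//.
apply: le_integrable (integrableD _ i1 i2) => //=; first exact/measurable_EFinP.
move=> w _; rewrite lee_fin [leRHS]ger0_norm ?addr_ge0 ?exprn_ge0//.
have := sqr_ge0 (`|X w| - 1); have := normr_ge0 (X w); nra.
Qed.

Section fine_integral.
Context d (U : measurableType d) (R : realType).
Variables (mu : {measure set U -> \bar R}) (D : set U) (mD : measurable D).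
Variables (f : U -> \bar R) (f_int : mu.-integrable D f).

Lemma integrable_fine : mu.-integrable D (EFin \o (fine \o f)).
Proof.
apply: le_integrable f_int => //=.
  apply/measurable_EFinP; apply: measurableT_comp => //.
  exact: measurable_int f_int.
by move=> x _; case: (f x) => [r||] /=; rewrite ?normr0 ?leey.
Qed.

Lemma ae_fineK : ae_eq mu D (EFin \o (fine \o f)) f.
Proof. by apply: filterS (integrable_ae mD f_int) => x fx /fx /= ?; rewrite fineK. Qed.

Lemma integral_fine : (\int[mu]_(x in D) (fine (f x))%:E = \int[mu]_(x in D) f x)%E.
Proof.
apply: ae_eq_integral => //; last exact: ae_fineK.
- exact: measurable_int integrable_fine.
- exact: measurable_int f_int.
Qed.

Lemma Rintegral_fine : \int[mu]_(x in D) fine (f x) = fine (\int[mu]_(x in D) f x)%E.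
Proof. by rewrite /Rintegral integral_fine. Qed.

End fine_integral.

(** Only the values of a process at the times in [D] are controlled, so that
    Tonelli and Fubini are applied to its extension by zero outside [D]. *)
Section integrable_process.
Context d (Omega : measurableType d) (R : realType).
Local Notation mu := (@lebesgue_measure R).
Variables (P : probability Omega R) (D : set R) (mD : measurable D).
Variable X : R -> Omega -> R.

Definition integrable_process :=
  (mu \x P)%E.-integrable (D `*` setT) (fun p => (X p.1 p.2)%:E).

Let g : R * Omega -> \bar R := (fun p => (X p.1 p.2)%:E) \_ (D `*` setT).

Let mDT : measurable (D `*` [set: Omega]). Proof. exact: measurableX. Qed.

Let gE s w : g (s, w) = ((fun r => (X r w)%:E) \_ D) s.
Proof.
by rewrite /g !patchE; congr (if _ then _ else _); rewrite in_setX in_setT andbT.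
Qed.

Let integrable_processP : integrable_process <-> (mu \x P)%E.-integrable setT g.
Proof. exact: integrable_mkcond. Qed.

Section tonelli.
Hypothesis mX : measurable_fun (D `*` setT) (fun p => X p.1 p.2).

Let mg : measurable_fun setT g.
Proof. by apply/(measurable_restrictT _ mDT); exact/measurable_EFinP. Qed.

Lemma integrable_process12 :
  (\int[mu]_(s in D) \int[P]_w `|X s w|%:E < +oo)%E -> integrable_process.
Proof.
move=> Xoo; apply/integrable_processP/integrable12ltyP => //.
apply: le_lt_trans Xoo; rewrite [leRHS]integral_mkcond le_eqVlt.
apply/orP; left; apply/eqP; apply: eq_integral => s _; rewrite patchE.
case: ifPn => sD; last first.
  by apply: integral0_eq => w _; rewrite gE patchE (negbTE sD) /= normr0.
by apply: eq_integral => w _; rewrite gE patchE sD.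
Qed.

Lemma integrable_process21 :
  (\int[P]_w \int[mu]_(s in D) `|X s w|%:E < +oo)%E -> integrable_process.
Proof.
move=> Xoo; apply/integrable_processP/integrable21ltyP => //.
apply: le_lt_trans Xoo; rewrite le_eqVlt; apply/orP; left; apply/eqP.
apply: eq_integral => w _; rewrite [RHS]integral_mkcond.
apply: eq_integral => s _; rewrite gE !patchE.
by case: ifP => //=; rewrite normr0.
Qed.

End tonelli.

Section fubini.
Hypothesis X_int : integrable_process.

Let g_int : (mu \x P)%E.-integrable setT g.
Proof. exact/integrable_processP. Qed.

Let mg : measurable_fun setT g. Proof. exact: measurable_int g_int. Qed.

Lemma ae_integrable_path :
  {ae P, forall w, mu.-integrable D (fun s => (X s w)%:E)}.
Proof.
apply: filterS (ae_integrable2 g_int) => w gw.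
apply/(@integrable_mkcond _ _ _ mu D (fun s => (X s w)%:E) mD).
by apply: eq_integrable gw => // s _; exact: gE.
Qed.

Let int_gD s : D s -> (\int[P]_w g (s, w) = 'E_P[X s])%E.
Proof.
move=> Ds; rewrite unlock; apply: eq_integral => w _.
by rewrite gE patchE mem_set.
Qed.

Let int_gND s : ~ D s -> (\int[P]_w g (s, w) = 0)%E.
Proof.
by move=> Ds; apply: integral0_eq => w _; rewrite gE patchE memNset.
Qed.

Let int_gE : (fun s => \int[P]_w g (s, w))%E = (fun s => 'E_P[X s])%E \_ D.
Proof.
apply/funext => s; rewrite patchE; case: ifPn => [/set_mem/int_gD//|].
by move/negP => nD; apply: int_gND => /mem_set.
Qed.

Lemma integrable_expectation_process : mu.-integrable D (fun s => 'E_P[X s])%E.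
Proof. by apply/integrable_mkcond => //; rewrite -int_gE; exact: integrable_fubini_F. Qed.

Let int_gw : fubini_G mu g = (fun w => \int[mu]_(s in D) (X s w)%:E)%E.
Proof.
by apply/funext => w; rewrite [RHS]integral_mkcond; apply: eq_integral => s _; rewrite gE.
Qed.

Let int_w_integrable : P.-integrable setT (fun w => \int[mu]_(s in D) (X s w)%:E)%E.
Proof.
have mI : measurable_fun setT (fun w => \int[mu]_(s in D) (X s w)%:E)%E.
  by rewrite -int_gw; exact: measurable_fubini_G g_int.
have mag : measurable_fun setT (fun p => `|g p|)%E by exact: measurableT_comp.
apply/integrableP; split => //.
have /integrable21ltyP -/(_ mg) := g_int.
apply: le_lt_trans; apply: ge0_le_integral => //.
- exact: measurableT_comp.
- exact: (@measurable_fun_fubini_tonelli_G _ _ _ _ _ mu (fun p => `|g p|)%E).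
move=> w _.
rewrite -[X in (`|X| <= _)%E]/((fun w => \int[mu]_(s in D) (X s w)%:E)%E w) -int_gw.
by apply: le_abse_integral => //; exact: measurableT_comp.
Qed.

Lemma integrable_Rintegral_process :
  P.-integrable setT (EFin \o (fun w => \int[mu]_(s in D) X s w)).
Proof. exact: (integrable_fine measurableT int_w_integrable). Qed.

Lemma expectation_Rintegral_process :
  ('E_P[fun w => (\int[mu]_(s in D) X s w)%R] = \int[mu]_(s in D) 'E_P[X s])%E.
Proof.
rewrite [in LHS]unlock /Rintegral (integral_fine measurableT int_w_integrable).
rewrite -int_gw integral21_prod_meas1// -integral12_prod_meas1// [RHS]integral_mkcond.
by apply: eq_integral => s _; rewrite -int_gE.
Qed.

End fubini.

End integrable_process.

Lemma integrable_processS d (Omega : measurableType d) (R : realType)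
    (P : probability Omega R) (D D' : set R) (X : R -> Omega -> R) :
  measurable D -> measurable D' -> D' `<=` D ->
  integrable_process P D X -> integrable_process P D' X.
Proof.
move=> mD mD' D'D; apply: integrableS => //; try exact: measurableX.
by move=> [s w] [/= /D'D].
Qed.

(** * Centered random variables *)

Section expectation_fine.
Context d (Omega : measurableType d) (R : realType) (P : probability Omega R).
Implicit Types X Y : Omega -> R.

Lemma expectation_fineK X : P.-integrable setT (EFin \o X) ->
  (fine 'E_P[X])%:E = 'E_P[X]%E.
Proof. by move=> iX; rewrite fineK// expectation_fin_num//; exact/Lfun1_integrable. Qed.

Lemma fine_expectationD X Y : P.-integrable setT (EFin \o X) ->
  P.-integrable setT (EFin \o Y) ->
  fine 'E_P[fun w => (X w + Y w)%R] = fine 'E_P[X] + fine 'E_P[Y].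
Proof.
move=> iX iY; rewrite (@expectationD _ _ _ P X Y); last 2 first.
- exact/Lfun1_integrable.
- exact/Lfun1_integrable.
by rewrite fineD// expectation_fin_num//; exact/Lfun1_integrable.
Qed.

Lemma integrable_EFinD X Y : P.-integrable setT (EFin \o X) ->
  P.-integrable setT (EFin \o Y) ->
  P.-integrable setT (EFin \o (fun w => X w + Y w)).
Proof. by move=> iX iY; exact: (integrableD measurableT iX iY). Qed.

Lemma ae_eq_expectation X Y : P.-integrable setT (EFin \o X) ->
  P.-integrable setT (EFin \o Y) -> {ae P, forall w, X w = Y w} ->
  'E_P[X]%E = 'E_P[Y]%E.
Proof.
move=> iX iY XY; rewrite unlock; apply: ae_eq_integral => //.
- exact: measurable_int iX.
- exact: measurable_int iY.
- by apply: filterS XY => w /= -> _.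
Qed.

End expectation_fine.

(** The mean is determined by the law, so it equals its own opposite. *)
Lemma expectation_symmetric d (Omega : measurableType d) (R : realType)
    (P : probability Omega R) (X : Omega -> R) :
  measurable_fun setT X -> P.-integrable setT (EFin \o X) ->
  (forall C : set R, measurable C ->
    P (X @^-1` C) = P ((fun w => - X w) @^-1` C)) ->
  'E_P[X]%E = 0.
Proof.
move=> mX iX symX.
have mNX : measurable_fun setT (fun w => - X w) by exact: measurableT_comp.
have iNX : P.-integrable setT (EFin \o (fun w => - X w)).
  by have := integrableN iX.
have mE : measurable_fun [set: R] (@EFin R) by [].
have e1 : (\int[P]_w (X w)%:E = \int[P]_w (- X w)%:E)%E.
  have := integral_pushforward mX (mu := P) (D := setT) mE.
  rewrite preimage_setT => /(_ iX measurableT) /= <-.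
  have := integral_pushforward mNX (mu := P) (D := setT) mE.
  rewrite preimage_setT => /(_ iNX measurableT) /= <-.
  by apply: eq_measure_integral => C mC _; exact: symX.
have := integrable_fin_num measurableT iX.
rewrite unlock; move: e1; under [X in _ = X -> _]eq_integral do rewrite EFinN.
rewrite integralN; last first.
  exact: (@integrable_add_def _ _ _ P setT measurableT (fun w => (X w)%:E) iX).
rewrite /=; case: (\int[P]_w (X w)%:E)%E => [r||]//= [] rN _.
by congr EFin; lra.
Qed.

Section centered.
Context d (Omega : measurableType d) (R : realType) (P : probability Omega R).
Implicit Types X Y : Omega -> R.

Definition centered X := P.-integrable setT (EFin \o X) /\ ('E_P[X] = 0)%E.

Lemma centered0 : centered (fun=> 0).
Proof. by split; [exact: integrable0|rewrite (expectation_cst P 0)]. Qed.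

Lemma centeredD X Y : centered X -> centered Y -> centered (fun w => X w + Y w).
Proof.
move=> [iX X0] [iY Y0]; split; first exact: (integrableD measurableT iX iY).
rewrite (@expectationD _ _ _ P X Y); last 2 first.
- exact/Lfun1_integrable.
- exact/Lfun1_integrable.
by rewrite X0 Y0 adde0.
Qed.

Lemma centeredZ k X : centered X -> centered (fun w => k * X w).
Proof.
move=> [iX X0]; split; first exact: (integrableZl measurableT k iX).
move: X0; rewrite unlock; under [X in _ -> X = _]eq_integral do rewrite EFinM.
by rewrite integralZl// => ->; rewrite mule0.
Qed.

Lemma centered_sum n (X : nat -> Omega -> R) :
  (forall i, (i < n)%N -> centered (X i)) ->
  centered (fun w => \sum_(i < n) X i w).
Proof.
elim: n => [|n IHn] cX.
  by under eq_fun do rewrite big_ord0; exact: centered0.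
under eq_fun do rewrite big_ord_recr/=.
by apply: centeredD; [apply: IHn => i /ltnW/cX|exact: cX].
Qed.

(** E X = E (X - Y) for every centered [Y], so that |E X| is bounded by the L^1
    distance from [X] to the centered variables. *)
Lemma centered_approx X : measurable_fun setT X ->
  (forall e, 0 < e -> exists2 Y, centered Y &
     (\int[P]_w `|X w - Y w|%:E <= e%:E)%E) ->
  centered X.
Proof.
move=> mX approx.
have bound e : 0 < e -> P.-integrable setT (EFin \o X) /\ (`|'E_P[X]| <= e%:E)%E.
  move=> /approx[Y [iY Y0] XYe].
  have mY : measurable_fun setT Y by apply/measurable_EFinP; exact: measurable_int iY.
  have iXY : P.-integrable setT (EFin \o (fun w => X w - Y w)).
    apply/integrableP; split; last exact: le_lt_trans XYe (ltry _).
    by apply/measurable_EFinP; exact: measurable_funB.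
  have XE : X = (fun w => (X w - Y w) + Y w) by apply/funext => w; rewrite subrK.
  have iX : P.-integrable setT (EFin \o X).
    by rewrite XE; exact: (integrableD measurableT iXY iY).
  split => //; rewrite XE.
  rewrite (@expectationD _ _ _ P (fun w => X w - Y w) Y); last 2 first.
  - exact/Lfun1_integrable.
  - exact/Lfun1_integrable.
  rewrite Y0 adde0 unlock; apply: le_trans XYe.
  by apply: le_abse_integral => //; exact: measurable_int iXY.
split; first by have [] := bound 1 ltr01.
apply/eqP; rewrite -abse_eq0 eq_le abse_ge0 andbT.
by apply/lee_addgt0Pr => e /bound[_]; rewrite add0e.
Qed.

End centered.

Section independence.
Context d (Omega : measurableType d) (R : realType) (P : probability Omega R).
Variables (G : set (set Omega)) (X : Omega -> R).
Hypotheses (G_sub : G `<=` measurable) (mX : measurable_fun setT X).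
Hypothesis X_int : P.-integrable setT (EFin \o X).
Hypothesis X_sym : forall C : set R, measurable C ->
  P (X @^-1` ((-%R : R -> R) @^-1` C)) = P (X @^-1` C).
Hypothesis X_indep : independent_of P G X.

(** On [A] the product is [X] and off [A] it vanishes; by independence its law is
    P(A) law(X) + P(~ A) dirac_0, which is symmetric because the law of [X] is. *)
Lemma centered_indicator_mul (A : set Omega) : G A ->
  centered P (fun w => \1_A w * X w).
Proof.
move=> GA; have mA := G_sub GA.
have mAX : measurable_fun setT (fun w => \1_A w * X w).
  by apply: measurable_funM => //; exact: measurable_indic.
have iAX : P.-integrable setT (EFin \o (fun w => \1_A w * X w)).
  apply: le_integrable X_int => //; first exact/measurable_EFinP.
  move=> w _; rewrite /= lee_fin normrM ler_piMl// indicE.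
  by case: (w \in A); rewrite ?normr0 ?normr1.
have mopp (C : set R) : measurable C -> measurable ((-%R : R -> R) @^-1` C).
  by move=> mC; rewrite -[X in measurable X]setTI; exact: oppr_measurable.
have law (C : set R) : measurable C ->
    P ((fun w => \1_A w * X w) @^-1` C) =
    (P A * P (X @^-1` C) + (0 \in C)%:R%:E * P (~` A))%E.
  move=> mC; rewrite -X_indep//.
  have mXC : measurable (X @^-1` C).
    by rewrite -[X in measurable X]setTI; exact: mX.
  rewrite (measureDI P _ mA); last first.
    by rewrite -[X in measurable X]setTI; exact: mAX.
  rewrite addeC; congr (P _ + _)%E.
    apply/seteqP; split => w /=.
      by move=> [+ Aw]; rewrite indicE mem_set// mul1r.
    by move=> [Aw]; rewrite indicE mem_set// mul1r.
  have [C0|C0] := boolP (0 \in C).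
    rewrite mul1e; congr (P _); apply/seteqP; split => w /=; first by move=> [].
    by move=> nAw; split => //; rewrite indicE memNset// mul0r; exact: set_mem.
  rewrite mul0e -[RHS](measure0 P); congr (P _); apply/seteqP; split => w //=.
  move=> [+ nAw]; rewrite indicE memNset// mul0r => /mem_set.
  by apply/negP.
split => //; apply: expectation_symmetric => // C mC.
rewrite [LHS]law//.
rewrite [RHS](law _ (mopp _ mC)) X_sym//; congr (_ + (nat_of_bool _)%:R%:E * _)%E.
by apply/idP/idP => /set_mem /= h; apply/mem_set; rewrite /= oppr0 in h *.
Qed.

(** Rounding [h] down to a grid of mesh 1 / n changes [h * X] by at most |X| / n
    and turns it into a combination of the products of the previous lemma. *)
Lemma centered_bounded_mul (h : Omega -> R) (M : R) :
  measurable_wrt G h -> (forall w, `|h w| <= M) ->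
  centered P (fun w => h w * X w).
Proof.
move=> mGh hM.
have mh : measurable_fun setT h.
  by move=> _ C mC; rewrite setTI; exact/G_sub/mGh.
apply: centered_approx => [|e e0]; first exact: measurable_funM.
have /integrable_norm := X_int => /(integrable_fin_num measurableT).
set c := integral _ _ _ => cfin.
have c0 : (0 <= c)%E by apply: integral_ge0 => w _; rewrite /= lee_fin.
(* mesh of the discretisation of the values of h *)
pose n := (Num.truncn (fine c / e)).+1.
have n0 : 0 < n%:R :> R by rewrite ltr0n.
pose N := (Num.truncn (n%:R * (2 * M) : R)).+1.
pose lvl k : R := k%:R / n%:R - M.
pose A k := h @^-1` `[lvl k, lvl k.+1[.
pose Y w := \sum_(k < N) lvl k * (\1_(A k) w * X w).
exists Y.
  apply: (@centered_sum _ _ _ _ _ (fun k w => lvl k * (\1_(A k) w * X w))) => k _.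
  by apply: centeredZ; apply: centered_indicator_mul; exact: mGh.
have hY w : `|h w * X w - Y w| <= n%:R^-1 * `|X w|.
  have hw : 0 <= n%:R * (h w + M).
    by rewrite mulr_ge0// -lerBlDr sub0r; have := hM w; rewrite ler_norml => /andP[].
  have := hM w; rewrite ler_norml => /andP[_ hwM].
  pose k0 := Num.truncn (n%:R * (h w + M)).
  have k0N : (k0 < N)%N.
    by rewrite ltnS /k0; apply: le_truncn; rewrite ler_pM2l//; lra.
  have /andP[k0l k0u] := truncn_itv hw.
  have AE k : (w \in A k) = (k == k0).
    have -> : (w \in A k) = (k%:R <= n%:R * (h w + M) < k.+1%:R).
      rewrite (mulrC n%:R) -ler_pdivrMr// -ltr_pdivlMr// -lerBlDr -ltrBrDr.
      by rewrite /A /lvl; apply/idP/idP => [/set_mem|?]; [|apply/mem_set]; rewrite /= in_itv.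
    apply/idP/eqP => [/truncn_def//|->]; exact/andP.
  rewrite /Y (bigD1 (Ordinal k0N))//= big1 ?addr0; last first.
    by move=> k kk0; rewrite indicE AE -val_eqE/= in kk0 *; rewrite (negbTE kk0) mul0r mulr0.
  rewrite indicE AE eqxx mul1r -mulrBl normrM ler_wpM2r//.
  have -> : h w - lvl k0 = (n%:R * (h w + M) - k0%:R) / n%:R.
    by rewrite /lvl; field; rewrite gt_eqF.
  rewrite ger0_norm; last by rewrite divr_ge0// subr_ge0.
  by rewrite ler_pdivrMr// mulVf ?gt_eqF// lerBlDl natr1 ltW.
apply: (@le_trans _ _ (\int[P]_w (n%:R^-1 * `|X w|)%:E)%E).
  by apply: ge0_le_lower_integral => w _; rewrite lee_fin.
under eq_integral do rewrite EFinM.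
rewrite integralZl//; last exact: integrable_norm.
rewrite -/c -(fineK cfin) lee_fin ler_pdivrMl// -ler_pdivrMr//.
have /truncn_itv/andP[_ /ltW] : 0 <= fine c / e by apply: divr_ge0; [exact: fine_ge0|exact: ltW].
exact.
Qed.

End independence.

(** * The Ito integral has mean zero *)

Section centered_normal.
Context {R : realType}.
Local Notation mu := (@lebesgue_measure R).
Variables (s : R) (s_neq0 : s != 0).

Lemma normal_pdf_even x : normal_pdf 0 s (- x) = normal_pdf 0 s x.
Proof. by rewrite !normal_pdfE// /normal_fun !subr0 sqrrN. Qed.

Lemma normal_prob_symmetric (C : set R) : measurable C ->
  normal_prob 0 s ((-%R : R -> R) @^-1` C) = normal_prob 0 s C.
Proof.
move=> mC; rewrite /normal_prob.
have mpdf : measurable_fun C (fun x => (normal_pdf 0 s x)%:E).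
  by apply/measurable_EFinP; apply: measurable_funTS; exact: measurable_normal_pdf.
have mN : measurable_fun [set: measurableTypeR R] (-%R : _ -> measurableTypeR R).
  exact: oppr_measurable.
transitivity (\int[pushforward mu (-%R : _ -> measurableTypeR R)]_(x in C)
    (normal_pdf 0 s x)%:E)%E.
  rewrite ge0_integral_pushforward//; last first.
    by move=> x _; rewrite lee_fin normal_pdf_ge0.
  by apply: eq_integral => x _ /=; rewrite normal_pdf_even.
by apply: eq_measure_integral => A mA _; exact: lebesgue_measureN.
Qed.

(** Half of the Gaussian exponent absorbs the factor |x|: with u the square of
    x / (2 s), one has |x| <= |s| (1 + u) <= |s| exp u, and multiplying the density
    by exp u replaces [s] by sqrt 2 * [s]. *)
Lemma normal_pdf_first_moment x :
  `|x| * normal_pdf 0 s x <=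
  `|s| * normal_peak s / normal_peak (Num.sqrt 2 * s) * normal_pdf 0 (Num.sqrt 2 * s) x.
Proof.
have s20 : Num.sqrt 2 * s != 0 by rewrite mulf_neq0// gt_eqF// sqrtr_gt0.
rewrite !normal_pdfE// /normal_fun !subr0 exprMn sqr_sqrtr//.
have p0 := normal_peak_gt0 s20; have p1 := normal_peak_gt0 s_neq0.
move: p0 p1; set b := normal_peak _; set a := normal_peak _ => b0 a0.
set e1 := expR _; set e2 := expR _.
have -> : `|s| * a / b * (b * e2) = a * (`|s| * e2) by field; rewrite gt_eqF.
have -> : `|x| * (a * e1) = a * (`|x| * e1) by ring.
rewrite ler_pM2l// {}/e1 {}/e2.
set u := x ^+ 2 / (2 * s ^+ 2 *+ 2).
have us : s ^+ 2 != 0 by rewrite sqrf_eq0.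
have -> : - x ^+ 2 / (s ^+ 2 *+ 2) = - u - u.
  by rewrite /u; field.
have -> : - x ^+ 2 / (2 * s ^+ 2 *+ 2) = - u by rewrite /u mulNr.
rewrite expRD mulrA ler_pM2r ?expR_gt0// expRN ler_pdivrMr ?expR_gt0//.
apply: (@le_trans _ _ (`|s| * (1 + u))); last first.
  by rewrite ler_wpM2l// expR_ge1Dx.
have s0 : 0 < `|s| by rewrite normr_gt0.
set v := `|x| / `|s|.
have -> : u = v ^+ 2 / 4.
  by rewrite /u /v expr_div_n !real_normK ?num_real//; field.
have -> : `|x| = `|s| * v by rewrite /v; field; rewrite gt_eqF.
rewrite ler_pM2l//.
have := sqr_ge0 (v / 2 - 1); nra.
Qed.

(** [normal_prob] is defined by integrating a density over sets; the Radon-Nikodym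
    theorem turns integrals against it into integrals against the density. *)
Lemma normal_prob_integrable_id :
  (\int[normal_prob 0 s]_x `|x|%:E < +oo)%E.
Proof.
have dom := @normal_prob_dominates R 0 s.
have mnorm : measurable_fun [set: measurableTypeR R] (fun x : R => `|x|%:E).
  by apply/measurable_EFinP; exact: normr_measurable.
rewrite -(Radon_Nikodym_SigmaFinite.change_of_variables dom)//.
set g := Radon_Nikodym_SigmaFinite.f _ _.
have gE : ae_eq mu setT g (EFin \o normal_pdf 0 s).
  apply: integral_ae_eq => //.
  - exact: Radon_Nikodym_SigmaFinite.f_integrable.
  - by apply/measurable_EFinP; exact: measurable_normal_pdf.
  - by move=> A _ mA; rewrite -Radon_Nikodym_SigmaFinite.f_integral.
rewrite (_ : integral _ _ _ = \int[mu]_x (`|x| * normal_pdf 0 s x)%:E)%E; last first.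
  apply: ae_eq_integral => //.
  - apply: emeasurable_funM => //.
    exact: measurable_int (Radon_Nikodym_SigmaFinite.f_integrable dom).
  - apply/measurable_EFinP; apply: measurable_funM; first exact: normr_measurable.
    exact: measurable_normal_pdf.
  - by apply: filterS gE => x /= /(_ I) -> _.
set k := `|s| * normal_peak s / normal_peak (Num.sqrt 2 * s).
apply: (@le_lt_trans _ _ (\int[mu]_x (k * normal_pdf 0 (Num.sqrt 2 * s) x)%:E)%E).
  apply: ge0_le_lower_integral => x _; rewrite lee_fin.
    by rewrite mulr_ge0 ?normal_pdf_ge0.
  exact: normal_pdf_first_moment.
under eq_integral do rewrite EFinM.
rewrite integralZl//=; last exact: integrable_normal_pdf.
by rewrite integral_normal_pdf mule1 ltry.
Qed.

End centered_normal.

Section brownian_integral.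
Context (R : realType) (d : measure_display) (Omega : measurableType d).
Variables (P : probability Omega R) (T : R).
Variables (F : R -> set (set Omega)) (B : R -> Omega -> R).
Hypotheses (F_filtration : is_filtration T F) (B_brownian : is_brownian_motion P T F B).

Lemma adapted_measurable X t : adapted T F X -> t \in `[0, T] ->
  measurable_fun setT (X t).
Proof.
move=> aX t0T _ C mC; rewrite setTI.
exact/(filtration_sub F_filtration t0T)/aX.
Qed.

Let brownian_increment_law s t (C : set R) : 0 <= s -> s < t -> t <= T ->
  measurable C -> pushforward P (fun w => B t w - B s w) C =
    normal_prob 0 (Num.sqrt (t - s)) C.
Proof. by move=> s0 st tT mC; rewrite -(bm_normal B_brownian). Qed.

Lemma centered_brownian_increment_mul s t (h : Omega -> R) (M : R) :
  0 <= s -> s <= t -> t <= T -> measurable_wrt (F s) h ->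
  (forall w, `|h w| <= M) ->
  centered P (fun w => h w * (B t w - B s w)).
Proof.
move=> s0; rewrite le_eqVlt => /predU1P[<- _ _ _|st tT mh hM].
  by under eq_fun do rewrite subrr mulr0; exact: centered0.
have sT : s <= T by apply: le_trans tT; exact: ltW.
have s0T : s \in `[0, T] by rewrite in_itv/= s0.
have t0T : t \in `[0, T] by rewrite in_itv/= tT (le_trans s0)// ltW.
have mX : measurable_fun setT (fun w => B t w - B s w).
  by apply: measurable_funB; apply: adapted_measurable => //; exact: bm_adapted B_brownian.
have sd0 : Num.sqrt (t - s) != 0 by rewrite gt_eqF// sqrtr_gt0 subr_gt0.
apply: (@centered_bounded_mul _ _ _ P (F s) (fun w => B t w - B s w) _ mX _ _ _ h M) => //.
- exact: filtration_sub F_filtration _ s0T.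
- apply/integrableP; split; first exact/measurable_EFinP.
  have mn : measurable_fun [set: measurableTypeR R] (fun y : R => `|y|%:E).
    by apply/measurable_EFinP; exact: normr_measurable.
  have := normal_prob_integrable_id sd0.
  apply: le_lt_trans; rewrite le_eqVlt; apply/orP; left; apply/eqP.
  have mX' : @measurable_fun _ _ Omega (measurableTypeR R) setT
    (fun w => B t w - B s w) := mX.
  have := ge0_integral_pushforward mX' P measurableT mn.
  rewrite preimage_setT /= => <-; last by move=> y _; rewrite lee_fin.
  by apply: eq_measure_integral => C mC _; exact: brownian_increment_law.
- move=> C mC; have mNC : measurable ((-%R : R -> R) @^-1` C).
    by rewrite -[X in measurable X]setTI; exact: oppr_measurable.
  have := brownian_increment_law s0 st tT mNC.
  by rewrite normal_prob_symmetric// -(brownian_increment_law s0 st tT mC).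
- exact: (bm_independent B_brownian s0 st tT).
Qed.

Lemma centered_sp_integral (H : simple_process T F) t : t \in `[0, T] ->
  centered P (sp_integral B H t).
Proof.
rewrite in_itv/= => /andP[t0 tT]; have [M HM] := sp_coef_bounded H.
have time_ge0 i : (i <= sp_size H)%N -> 0 <= sp_time H i.
  elim: i => [_|i IHi iH]; first exact: sp_time_ge0.
  by apply: le_trans (IHi (ltnW iH)) _; exact: sp_time_nondecreasing.
apply: (@centered_sum _ _ _ P _ (fun i w => sp_coef H i w *
  (B (Num.min (sp_time H i.+1) t) w - B (Num.min (sp_time H i) t) w))) => i iH.
have nd := sp_time_nondecreasing iH.
have [ti|] := boolP (t <= sp_time H i).
  rewrite (min_idPr (le_trans ti nd)) (min_idPr ti).
  by under eq_fun do rewrite subrr mulr0; exact: centered0.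
rewrite -ltNge => /ltW it; rewrite (min_idPl it).
apply: (@centered_brownian_increment_mul _ _ _ M) => //.
- exact/time_ge0/ltnW.
- by rewrite le_min nd it.
- by rewrite ge_min tT orbT.
- exact: sp_coef_measurable.
- by move=> w; exact: HM.
Qed.

(** The Ito integral is an L^2 limit of centered integrals of simple processes,
    and L^2 convergence implies L^1 convergence under a probability. *)
Lemma centered_ito_integral Z I t : is_ito_integral P T F B Z I ->
  t \in `[0, T] -> centered P (I t).
Proof.
move=> [aI [H [_ HI]]] t0T; have := HI t t0T; rewrite unlock => cvgH.
apply: centered_approx => [|e e0]; first exact: adapted_measurable.
have e20 : 0 < e ^+ 2 by rewrite exprn_gt0.
have [k _ /(_ k (leqnn k)) Hk] : \forall k \near \oo,
    (\int[P]_w (`|sp_integral B (H k) t w - I t w|%R ^+ 2)%:E < (e ^+ 2)%:E)%E.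
  have := cvgH; move/(_ [set x | (x < (e ^+ 2)%:E)%E]); apply.
  have : (0 < (e ^+ 2)%:E :> \bar R)%E by rewrite lte_fin.
  exact: open_ereal_lt'.
have cS := centered_sp_integral (H k) t0T.
exists (sp_integral B (H k) t) => //.
have mS : measurable_fun setT (sp_integral B (H k) t).
  by apply/measurable_EFinP; exact: measurable_int cS.1.
have mI := adapted_measurable aI t0T.
have m2 : measurable_fun setT (fun w => `|sp_integral B (H k) t w - I t w| ^+ 2).
  apply: measurable_funX; apply: measurableT_comp => //; exact: measurable_funB.
(* |x| <= e / 2 + x ^ 2 / (2 e) *)
apply: (@le_trans _ _ (\int[P]_w ((e / 2)%:E +
    (2 * e)^-1%:E * (`|sp_integral B (H k) t w - I t w|%R ^+ 2)%:E))%E).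
  apply: ge0_le_lower_integral => w _; first by rewrite lee_fin.
  rewrite -EFinM -EFinD lee_fin distrC.
  set x := `|_|.
  have -> : e / 2 + (2 * e)^-1 * x ^+ 2 = x + (2 * e)^-1 * (x - e) ^+ 2.
    by field; rewrite gt_eqF.
  by rewrite lerDl mulr_ge0 ?sqr_ge0// invr_ge0 mulr_ge0// ltW.
rewrite ge0_integralD//=; last 3 first.
- by move=> w _; rewrite lee_fin divr_ge0// ltW.
- by move=> w _; rewrite lee_fin mulr_ge0 ?sqr_ge0// invr_ge0 mulr_ge0// ltW.
- by apply: emeasurable_funM => //; exact/measurable_EFinP.
have e2E : (\int[P]__ (e / 2)%:E = (e / 2)%:E)%E by rewrite -[RHS](expectation_cst P) unlock.
rewrite e2E ge0_integralZl//; last 2 first.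
- exact/measurable_EFinP.
- by rewrite lee_fin invr_ge0 mulr_ge0// ltW.
apply: (@le_trans _ _ ((e / 2)%:E + (2 * e)^-1%:E * (e ^+ 2)%:E)%E).
  apply: leeD => //; apply: lee_wpmul2l; last exact: ltW.
  by rewrite lee_fin invr_ge0 mulr_ge0// ltW.
by rewrite -EFinM -EFinD lee_fin le_eqVlt; apply/orP; left; apply/eqP; field; rewrite gt_eqF.
Qed.

End brownian_integral.

(** * Joint measurability and integrability of the processes *)

Section joint_measurability.
Context d (Omega : measurableType d) (R : realType).
Variables (T : R) (X : R -> Omega -> R).
Hypothesis mX : forall t, t \in `[0, T] -> measurable_fun setT (X t).
Hypothesis cX : forall w, {within [set` `[0, T]], continuous (fun t => X t w)}.

Let grid n (t : R) : R := (Num.truncn (n.+1%:R * t))%:R / n.+1%:R.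

Let grid_itv n t : 0 <= t -> grid n t <= t < grid n t + n.+1%:R^-1.
Proof.
move=> t0; have /truncn_itv/andP[] : 0 <= n.+1%:R * t by rewrite mulr_ge0.
set k := Num.truncn _ => kl ku; rewrite /grid -/k ler_pdivrMr// mulrC kl/=.
by rewrite -[X in _ + X]mul1r -mulrDl ltr_pdivlMr// mulrC natr1.
Qed.

Let grid_ge0 n t : 0 <= grid n t. Proof. by rewrite divr_ge0. Qed.

Let grid_cvg t : 0 <= t -> grid n t @[n --> \oo] --> t.
Proof.
move=> t0; apply/cvgrPdist_le => e e0; near=> n.
have /andP[gl gu] := grid_itv n t0.
rewrite ger0_norm ?subr_ge0// lerBlDl ltW// (lt_le_trans gu)// lerD2l ltW//.
by near: n; exact: near_infty_natSinv_lt (PosNum e0).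
Unshelve. all: by end_near. Qed.

(** The process sampled at the grid point to the left of [t] is a countable
    gluing of measurable variables, and converges to [X] by continuity. *)
Lemma caratheodory_measurable :
  measurable_fun ([set` `[0, T]] `*` setT) (fun p => X p.1 p.2).
Proof.
apply: (@measurable_fun_cvg _ _ _ _ (fun n p => X (grid n p.1) p.2)); last first.
  move=> [t w] [/= t0T _].
  have t0 : 0 <= t by move: t0T; rewrite in_itv/= => /andP[].
  have /subspace_continuousP cXw := @cX w.
  move=> V XV; have := grid_cvg t0 (cXw _ t0T _ XV).
  apply: (@filterS _ \oo) => n; apply.
  rewrite /= in_itv/= grid_ge0/=; have /andP[+ _] := grid_itv n t0.
  by move=> /le_trans; apply; move: t0T; rewrite in_itv/= => /andP[].
move=> n mD C mC.
rewrite (_ : _ `&` _ = \bigcup_k (([set` `[0, T]] `&` [set t | k%:R / n.+1%:R <= t < k.+1%:R / n.+1%:R]) `*`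
   (if k%:R / n.+1%:R <= T then X (k%:R / n.+1%:R) @^-1` C else set0))); last first.
  apply/seteqP; split => [[t w] [[/= t0T _] XC]|[t w] [k _] [/= [t0T ktk]]].
    have t0 : 0 <= t by move: t0T; rewrite in_itv/= => /andP[].
    have tT : t <= T by move: t0T; rewrite in_itv/= => /andP[].
    have /andP[gl gu] := grid_itv n t0.
    exists (Num.truncn (n.+1%:R * t)) => //; split => /=.
      by split => //=; rewrite gl/= -natr1 mulrDl mul1r.
    by rewrite (le_trans gl tT).
  case: ifP => // kT XC; split => //=.
  have -> : grid n t = k%:R / n.+1%:R; last by [].
  by rewrite /grid; congr (_%:R / _); apply: truncn_def; rewrite mulrC -ler_pdivrMr// -ltr_pdivlMr.
apply: bigcupT_measurable => k; apply: measurableX.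
  apply: measurableI => //.
  exact: (measurable_itv `[k%:R / n.+1%:R, k.+1%:R / n.+1%:R[).
case: ifPn => // kT; rewrite -[X in measurable X]setTI; apply: mX => //.
by rewrite in_itv/= kT andbT divr_ge0.
Qed.

End joint_measurability.

Section processes.
Context (R : realType) (d : measure_display) (Omega : measurableType d).
Variables (P : probability Omega R) (T : R) (T_gt0 : 0 < T).
Variables (F : R -> set (set Omega)) (F_filtration : is_filtration T F).
Local Notation mu := (@lebesgue_measure R).
Local Notation D := [set` `[0, T]].

(** Only almost all paths are continuous: setting the others to zero gives
    a jointly measurable process indistinguishable from [Y]. *)
Lemma ae_continuous_modification (Y : R -> Omega -> R) :
  (forall t, t \in `[0, T] -> measurable_fun setT (Y t)) ->
  {ae P, forall w, {within D, continuous (fun t => Y t w)}} ->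
  exists2 Y' : R -> Omega -> R,
    measurable_fun (D `*` setT) (fun p => Y' p.1 p.2) &
    {ae P, forall w t, Y' t w = Y t w}.
Proof.
move=> mY [N [mN PN YN]].
exists (fun t w => \1_(~` N) w * Y t w).
  apply: (@caratheodory_measurable _ _ _ _ (fun t w => \1_(~` N) w * Y t w)).
    move=> t t0T; apply: measurable_funM; last exact: mY.
    by apply: measurable_indic; exact: measurableC.
  move=> w; rewrite indicE; have [wN|wN] := boolP (w \in ~` N); last first.
    rewrite (_ : (fun _ => _) = cst 0); last by apply/funext => t; rewrite mul0r.
    by move=> x; exact: cst_continuous.
  rewrite (_ : (fun _ => _) = (fun t => Y t w)); last by apply/funext => t; rewrite mul1r.
  move: wN => /set_mem; apply: contra_notP => ncY; exact: YN.
exists N; split => // w; apply: contra_notP => wN t.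
by rewrite indicE mem_set// mul1r.
Qed.

Lemma predictable_measurable (f : R -> Omega -> R) : predictable T F f ->
  measurable_fun (D `*` setT) (fun p => f p.1 p.2).
Proof.
move=> pf mD C mC; have := pf C mC; apply: smallest_sub => //.
  split => //; first by move=> A mA; exact: measurableD.
  by move=> A mA; exact: bigcupT_measurable.
have FT t A : 0 <= t -> t <= T -> F t A -> measurable A.
  by move=> t0 tT; apply: (filtration_sub F_filtration); rewrite in_itv/= t0.
move=> _ [[A F0A ->]|[s [t [A [s0 st tT FsA ->]]]]]; apply: measurableX => //.
- by apply: (FT 0) => //; exact: ltW.
- by apply: (FT s) => //; apply: le_trans tT; exact: ltW.
Qed.

Lemma H2_process_integrable (f : R -> Omega -> R) : H2_process P T F f ->
  integrable_process P D f.
Proof.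
move=> [/predictable_measurable mf f2].
have mD : measurable D by [].
have mDT : measurable (D `*` [set: Omega]) by exact: measurableX.
have mf2 : measurable_fun (D `*` setT) (fun p => `|f p.1 p.2| ^+ 2).
  by apply: measurable_funX; exact: measurableT_comp.
have i2 : integrable_process P D (fun t w => `|f t w| ^+ 2).
  apply: integrable_process21 => //.
  under eq_integral do under eq_integral do rewrite ger0_norm ?exprn_ge0//.
  exact: f2.
have i1 : integrable_process P D (fun _ _ => 1).
  apply: integrable_process12 => //; rewrite normr1.
  have -> : (\int[P]__ 1 = 1)%E by rewrite -[RHS](expectation_cst P 1) unlock.
  by rewrite integral_cst//= lebesgue_measure_itv/= lte_fin T_gt0 mul1e ltry.
have i12 := @integrableD _ _ _ (mu \x P)%E _ mDT _ _ i1 i2.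
rewrite /integrable_process; apply: (@le_integrable _ _ _ (mu \x P)%E _ mDT _ _ _ _ i12); first exact/measurable_EFinP.
move=> p _; rewrite lee_fin [leRHS]ger0_norm ?addr_ge0 ?exprn_ge0//.
have := sqr_ge0 (`|f p.1 p.2| - 1); have := normr_ge0 (f p.1 p.2); nra.
Qed.

Lemma L2_terminal_integrable (xi : Omega -> R) : L2_terminal P T F xi ->
  P.-integrable setT (EFin \o xi).
Proof.
move=> [mxi]; rewrite unlock => xi2; apply: sqr_integrable => // _ C mC.
rewrite setTI; apply: (filtration_sub F_filtration) (mxi _ mC).
by rewrite in_itv/= lexx ltW.
Qed.

Variable Y : R -> Omega -> R.
Hypothesis Y_S2 : S2_process P T F Y.

Lemma S2_bounded : exists C : R, forall t, t \in `[0, T] ->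
  (\int[P]_w (`|Y t w| ^+ 2)%:E <= C%:E)%E.
Proof.
have [_ _] := Y_S2; set S := integral _ _ _ => Soo.
have S0 : (0 <= S)%E.
  apply: integral_ge0 => w _; apply: ereal_sup_ge; exists (`|Y 0 w| ^+ 2)%:E.
    by exists 0 => //; rewrite /= in_itv/= lexx ltW.
  by rewrite lee_fin exprn_ge0.
exists (fine S) => t t0T; rewrite fineK ?ge0_fin_numE//.
apply: ge0_le_lower_integral => w _; first by rewrite lee_fin exprn_ge0.
by apply: ereal_sup_ubound; exists t.
Qed.

Lemma S2_measurable t : t \in `[0, T] -> measurable_fun setT (Y t).
Proof. by move=> t0T; have [aY _ _] := Y_S2; exact: (adapted_measurable F_filtration aY). Qed.

Lemma S2_integrable t : t \in `[0, T] -> P.-integrable setT (EFin \o Y t).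
Proof.
move=> t0T; have [C HC] := S2_bounded; apply: sqr_integrable.
  exact: S2_measurable.
exact: le_lt_trans (HC _ t0T) (ltry _).
Qed.

Lemma S2_first_moment_bounded : exists C : R, forall t, t \in `[0, T] ->
  (\int[P]_w `|Y t w|%:E <= C%:E)%E.
Proof.
have [C HC] := S2_bounded; exists (1 + C) => t t0T.
have mY := S2_measurable t0T.
apply: (@le_trans _ _ (\int[P]_w (1 + (`|Y t w| ^+ 2)%R%:E))%E).
  apply: ge0_le_lower_integral => w _; rewrite -?EFinD lee_fin//.
  have := sqr_ge0 (`|Y t w| - 1); have := normr_ge0 (Y t w); nra.
have e1 : (\int[P]__ 1 = 1)%E by rewrite -[RHS](expectation_cst P 1) unlock.
rewrite ge0_integralD//; last first.

  by apply/measurable_EFinP; apply: measurable_funX; exact: measurableT_comp.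
by rewrite e1 EFinD; apply: leeD => //; exact: HC.
Qed.

End processes.

(** * The equation satisfied by the mean *)

Section mean_equation.
Context (R : realType) (d : measure_display) (Omega : measurableType d).
Variables (P : probability Omega R) (T : R) (T_gt0 : 0 < T).
Variables (F : R -> set (set Omega)) (F_filtration : is_filtration T F).
Variables (B : R -> Omega -> R) (B_brownian : is_brownian_motion P T F B).
Variables (a : R -> R) (a_measurable : measurable_fun [set` `[0, T]] a).
Variables (M : R) (a_bounded : forall t, t \in `[0, T] -> `|a t| <= M).
Local Notation mu := (@lebesgue_measure R).
Local Notation D := [set` `[0, T]].

Variables (l : R -> R -> R) (f : R -> Omega -> R) (xi : Omega -> R).
Variables (Y Z : R -> Omega -> R) (K : I0T T).
Hypotheses (f_H2 : H2_process P T F f) (xi_L2 : L2_terminal P T F xi).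
Hypothesis Y_solution : mean_reflected_solution P F B l a f xi Y Z K.

Let Y_S2 : S2_process P T F Y := sol_Y Y_solution.
Let m t := fine 'E_P[Y t].

Let drift Y' : measurable_fun (D `*` setT) (fun p : R * Omega => Y' p.1 p.2) ->
  {ae P, forall w t, Y' t w = Y t w} ->
  integrable_process P D (fun s w => a s * Y' s w) /\
  forall s, s \in `[0, T] -> ('E_P[fun w => (a s * Y' s w)%R] = (a s * m s)%:E)%E.
Proof.
move=> mY' Y'Y.
have mD : measurable D by [].
have sectionY' s : s \in `[0, T] -> measurable_fun setT (Y' s).
  move=> s0T; have mDT : measurable (D `*` [set: Omega]) by exact: measurableX.
  apply: (@measurable_comp _ _ _ _ _ _ (D `*` setT) (fun p => Y' p.1 p.2) setT (pair s)) => //.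
  by move=> _ [w _ <-].
have Y'Ys s : ae_eq P setT (Y' s) (Y s) by apply: filterS Y'Y => w Yw _.
have iY' s : s \in `[0, T] -> P.-integrable setT (EFin \o Y' s).
  move=> s0T; have := S2_integrable T_gt0 F_filtration Y_S2 s0T.
  move=> /integrableP[mYs iYs]; apply/integrableP; split.
    by apply/measurable_EFinP; exact: sectionY'.
  rewrite (ae_eq_integral (fun w => `|(Y s w)%:E|)%E)//.
  - by apply: measurableT_comp => //; apply/measurable_EFinP; exact: sectionY'.
  - exact: measurableT_comp.
  - by apply: filterS (Y'Ys s) => w /= /(_ I) -> _.
split.
  apply: integrable_process12 => //.
    apply: measurable_funM; last exact: mY'.
    apply: (@measurable_comp _ _ _ _ _ _ D a (D `*` setT) fst) => //.
      by move=> _ [[s w] [sD _] <-].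
    exact: measurable_funTS.
  have [C HC] := S2_first_moment_bounded T_gt0 F_filtration Y_S2.
  apply: (@le_lt_trans _ _ (\int[mu]_(s in D) (M * C)%:E)%E).
    apply: ge0_le_lower_integral => s sD; first by apply: integral_ge0 => w _; rewrite lee_fin.
    have mYs := S2_measurable F_filtration Y_S2 sD.
    rewrite (ae_eq_integral (fun w => `|a s|%:E * `|Y s w|%:E)%E)//; last first.
    - by apply: filterS (Y'Ys s) => w /= /(_ I) -> _; rewrite normrM EFinM.
    - apply: emeasurable_funM => //; apply/measurable_EFinP; exact: measurableT_comp.
    - apply/measurable_EFinP; apply: measurableT_comp => //.
      by apply: measurable_funM => //; exact: sectionY'.
    rewrite ge0_integralZl//; last first.
      by apply/measurable_EFinP; exact: measurableT_comp.
    rewrite EFinM; apply: lee_pmul => //.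
    - by apply: integral_ge0 => w _; rewrite lee_fin.
    - by rewrite lee_fin a_bounded.
    - exact: HC.
  by rewrite integral_cst//= lebesgue_measure_itv/= lte_fin T_gt0 -EFinD -EFinM ltry.
move=> s s0T; rewrite unlock.
under eq_integral do rewrite EFinM.
rewrite integralZl//; last exact: iY'.
rewrite EFinM /m expectation_fineK; last exact: (S2_integrable T_gt0 F_filtration Y_S2 s0T).
rewrite unlock; congr (_ * _)%E; apply: ae_eq_integral => //.
- by apply/measurable_EFinP; exact: sectionY'.
- exact: measurable_int (S2_integrable T_gt0 F_filtration Y_S2 s0T).
- by apply: filterS (Y'Ys s) => w /= /(_ I) -> _.
Qed.

(** The expectations E f_s may be infinite for a null set of times [s], whence
    their integrability is stated in the extended reals. *)
Lemma mean_equation :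
  [/\ mu.-integrable D (fun s => (a s * m s)%:E),
      mu.-integrable D (fun s => 'E_P[f s]%E) &
      forall t, t \in `[0, T] -> m t = fine 'E_P[xi] +
        \int[mu]_(s in [set` `[t, T]]) (a s * m s + fine 'E_P[f s]) + (K T - K t)].
Proof.
have mD : measurable D by [].
have [_ cY _] := Y_S2.
have [Y' mY' Y'Y] := ae_continuous_modification (S2_measurable F_filtration Y_S2) cY.
have [iG EG] := drift mY' Y'Y.
have if_ := H2_process_integrable T_gt0 F_filtration f_H2.
have iam : mu.-integrable D (fun s => (a s * m s)%:E).
  apply: eq_integrable (integrable_expectation_process mD iG) => // s /set_mem sD.
  exact: EG.
have iEf := integrable_expectation_process mD if_.
split => // t t0T; have t0T' := t0T; move: t0T'; rewrite in_itv/= => /andP[t0 tT].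
pose Dt := [set` `[t, T]].
have mDt : measurable Dt by exact: measurable_itv.
have DtD : Dt `<=` D.
  by move=> s; rewrite /Dt /= !in_itv/= => /andP[ts ->]; rewrite (le_trans t0 ts).
have DtTD : Dt `*` [set: Omega] `<=` D `*` setT by move=> [s w] [/= /DtD].
have mDT : measurable (D `*` [set: Omega]) by exact: measurableX.
have iGt := integrable_processS mD mDt DtD iG.
have ift := integrable_processS mD mDt DtD if_.
have iEft := @integrableS _ _ _ mu _ _ _ mD mDt DtD iEf.
have iamt := @integrableS _ _ _ mu _ _ _ mD mDt DtD iam.
pose A1 w := \int[mu]_(s in Dt) (a s * Y' s w).
pose A2 w := \int[mu]_(s in Dt) f s w.
have iA1 : P.-integrable setT (EFin \o A1) := integrable_Rintegral_process mDt iGt.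
have iA2 : P.-integrable setT (EFin \o A2) := integrable_Rintegral_process mDt ift.
have EA1 : 'E_P[A1]%E = (\int[mu]_(s in Dt) (a s * m s)%:E)%E.
  rewrite [LHS](expectation_Rintegral_process mDt iGt).
  by apply: eq_integral => s /set_mem /DtD sD; exact: EG.
have EA2 : 'E_P[A2]%E = (\int[mu]_(s in Dt) 'E_P[f s])%E.
  exact: (expectation_Rintegral_process mDt ift).
have [I Iito eqY] := sol_equation Y_solution.
have T0T : T \in `[0, T] by rewrite in_itv/= lexx ltW.
have [iIt EIt] := centered_ito_integral F_filtration B_brownian Iito t0T.
have cIT := centeredZ (-1) (centered_ito_integral F_filtration B_brownian Iito T0T).
have iIT := cIT.1; have EIT := cIT.2.
have ixi := L2_terminal_integrable T_gt0 F_filtration xi_L2.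
have ik : P.-integrable setT (EFin \o cst (K T - K t)) by apply: finite_measure_integrable_cst.
have iX1 := integrable_EFinD ixi (integrable_EFinD iA1 iA2).
have iX2 := integrable_EFinD (integrable_EFinD iIT iIt) ik.
rewrite /m (ae_eq_expectation (S2_integrable T_gt0 F_filtration Y_S2 t0T) (integrable_EFinD iX1 iX2)).
  rewrite (fine_expectationD iX1 iX2) (fine_expectationD ixi (integrable_EFinD iA1 iA2)).
  rewrite (fine_expectationD iA1 iA2) (fine_expectationD (integrable_EFinD iIT iIt) ik).
  rewrite (fine_expectationD iIT iIt) EIT EIt EA1 EA2 expectation_cst /= !add0r.
  congr (_ + _ + _).
  have iEftf := @integrable_fine _ _ _ mu _ mDt _ iEft.
  rewrite [RHS](@RintegralD _ _ _ mu Dt (fun s => a s * m s) (fun s => fine 'E_P[f s]) mDt iamt iEftf).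
  by congr (_ + _); rewrite (@Rintegral_fine _ _ _ mu _ mDt _ iEft).
have := eqY t t0T.
have pG := ae_integrable_path mDt iGt; have pf := ae_integrable_path mDt ift.
move=> eY; apply: filterS2 (filterI Y'Y eY) (filterI pG pf) => w [Y'w ->] [Gw fw].
rewrite /A1 /A2 -RintegralD//.
under eq_Rintegral do rewrite -Y'w.
by rewrite /cst; ring.
Qed.

End mean_equation.

Section mean_trajectory.
Context (R : realType) (d : measure_display) (Omega : measurableType d).
Variables (P : probability Omega R) (T : R) (T_gt0 : 0 < T).
Variables (F : R -> set (set Omega)) (F_filtration : is_filtration T F).
Variables (B : R -> Omega -> R) (B_brownian : is_brownian_motion P T F B).
Variables (a : R -> R) (a_measurable : measurable_fun [set` `[0, T]] a).
Variables (M : R) (a_bounded : forall t, t \in `[0, T] -> `|a t| <= M).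
Local Notation mu := (@lebesgue_measure R).
Local Notation D := [set` `[0, T]].

Variables (l : R -> R -> R) (f : R -> Omega -> R) (xi : Omega -> R).
Variables (Y Z : R -> Omega -> R) (K : I0T T).
Hypotheses (f_H2 : H2_process P T F f) (xi_L2 : L2_terminal P T F xi).
Hypothesis Y_solution : mean_reflected_solution P F B l a f xi Y Z K.

Let m t := fine 'E_P[Y t].
Let b s := a s * m s + fine 'E_P[f s].

Let meanE := mean_equation T_gt0 F_filtration B_brownian a_measurable a_bounded
  f_H2 xi_L2 Y_solution.

Let b_int : mu.-integrable D (EFin \o b).
Proof.
have [iam iEf _] := meanE.
have iEff := @integrable_fine _ _ _ mu _ (measurable_itv _) _ iEf.
exact: (@integrableD _ _ _ mu _ (measurable_itv _) _ _ iam iEff).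
Qed.

Lemma mean_terminal : m T = fine 'E_P[xi].
Proof.
have [_ _ mE] := meanE.
rewrite [LHS]mE; last by rewrite in_itv/= lexx ltW.
by rewrite set_itv1 Rintegral_set1 subrr !addr0.
Qed.

(** Continuity in the upper bound of an integral is available, so the equation is
    rewritten with integrals over [0, t]. *)
Let mean_forward t : t \in `[0, T] ->
  m t = m 0 - \int[mu]_(s in [set` `[0, t]]) b s - K t.
Proof.
move=> t0T; have := t0T; rewrite in_itv/= => /andP[t0 tT].
have mE r : r \in `[0, T] ->
    m r = fine 'E_P[xi] + \int[mu]_(s in [set` `[r, T]]) b s + (K T - K r).
  by have [_ _] := meanE; apply.
rewrite [LHS]mE// [m 0]mE; last by rewrite in_itv/= lexx ltW.
have := @Rintegral_itvB _ b (BLeft 0) (BRight T) t b_int; rewrite !bnd_simp => /(_ t0 tT).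
rewrite Rintegral_itv_obnd_cbnd; last first.
  by apply: integrableS b_int => //; apply: subset_itvr; rewrite bnd_simp.
by rewrite /b I0T_zero => <-; ring.
Qed.

Lemma mean_continuous : {within D, continuous m}.
Proof.
have cP := parameterized_integral_continuous (ltW T_gt0) b_int.
have cK := @I0T_continuous R T K.
apply: (@subspace_eq_continuous _ _ _ (fun t => m 0 - parameterized_integral mu 0 t b - K t)).
  by move=> t /set_mem tD /=; rewrite [RHS]mean_forward.
move=> t; apply: cvgB; last exact: cK.
by apply: cvgB; [exact: cvg_cst|exact: cP].
Qed.

Lemma mean_increment s t : 0 <= s -> s <= t -> t <= T ->
  m s - m t = \int[mu]_(r in [set` `]s, t]]) (a r * m r) +
    fine (\int[mu]_(r in [set` `]s, t]]) 'E_P[f r])%E + (K t - K s).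
Proof.
move=> s0 st tT.
have stD : `]s, t] `<=` D.
  by move=> r /=; rewrite !in_itv/= => /andP[sr rt]; rewrite (le_trans s0 (ltW sr)) (le_trans rt).
have [iam iEf _] := meanE.
have mst : measurable (`]s, t]%classic : set R) by exact: measurable_itv.
have iamt := @integrableS _ _ _ mu _ _ _ (measurable_itv _) mst stD iam.
have iEft := @integrableS _ _ _ mu _ _ _ (measurable_itv _) mst stD iEf.
rewrite -(@Rintegral_fine _ _ _ mu _ mst _ iEft).
rewrite -(@RintegralD _ _ _ mu _ (fun s => a s * m s) (fun s => fine 'E_P[f s]) mst iamt
  (@integrable_fine _ _ _ mu _ mst _ iEft)).
rewrite -/b (mean_forward (t := s)) ?in_itv/= ?s0 ?(le_trans st)//.
rewrite (mean_forward (t := t)) ?in_itv/= ?tT ?(le_trans s0)//.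
have ib0t : mu.-integrable `[0, t] (EFin \o b).
  apply: integrableS b_int => //; apply: subset_itvl; by rewrite bnd_simp.
have := @Rintegral_itvB _ b (BLeft 0) (BRight t) s ib0t.
by rewrite !bnd_simp => /(_ s0 st) <-; ring.
Qed.

End mean_trajectory.

(** * Jensen's inequality and the slackness of the constraint *)

Section convexity.
Context {R : realType}.
Implicit Types (f : R -> R) (x y : R).

Lemma convexE f x y t : convex f -> 0 <= t -> t <= 1 ->
  f (t * x + (1 - t) * y) <= t * f x + (1 - t) * f y.
Proof.
move=> cf t0 t1; have := cf (Itv01 t0 t1) x y.
by rewrite !in_setT => /(_ isT isT).
Qed.

Lemma convex_slopes f x x0 y : convex f -> x < x0 -> x0 < y ->
  (f x0 - f x) / (x0 - x) <= (f y - f x0) / (y - x0).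
Proof.
move=> cf xx0 x0y; have xy : x < y by exact: lt_trans x0y.
rewrite ler_pdivrMr ?subr_gt0// mulrAC ler_pdivlMr ?subr_gt0//.
have t0 : 0 <= (y - x0) / (y - x) by rewrite divr_ge0// subr_ge0 ltW.
have t1 : (y - x0) / (y - x) <= 1.
  by rewrite ler_pdivrMr ?subr_gt0// mul1r lerD2l lerN2 ltW.
have := convexE x y cf t0 t1.
have -> : (y - x0) / (y - x) * x + (1 - (y - x0) / (y - x)) * y = x0.
  by field; rewrite subr_eq0 gt_eqF.
have -> : (y - x0) / (y - x) * f x + (1 - (y - x0) / (y - x)) * f y =
    ((y - x0) * f x + (x0 - x) * f y) / (y - x).
  by field; rewrite subr_eq0 gt_eqF.
rewrite ler_pdivlMr ?subr_gt0//; nra.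
Qed.

(** The slope is the left derivative at [x0], i.e. the supremum of the slopes of
    the chords ending at [x0]. *)
Lemma convex_supporting_line f x0 : convex f ->
  exists k, forall x, f x0 + k * (x - x0) <= f x.
Proof.
move=> cf; pose S := [set (f x0 - f x) / (x0 - x) | x in [set x | x < x0]].
have S0 : S !=set0 by exists ((f x0 - f (x0 - 1)) / (x0 - (x0 - 1))), (x0 - 1) => //=; lra.
have Sub y : x0 < y -> ubound S ((f y - f x0) / (y - x0)).
  by move=> x0y _ [x /= xx0 <-]; exact: convex_slopes.
exists (sup S) => x; case: (ltgtP x x0) => [xx0|x0x|->]; last by rewrite subrr mulr0 addr0.
- have : (f x0 - f x) / (x0 - x) <= sup S.
    apply: ub_le_sup; last by exists x.
    by exists ((f (x0 + 1) - f x0) / (x0 + 1 - x0)); apply: Sub; lra.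
  rewrite ler_pdivrMr ?subr_gt0//; nra.
- have : sup S <= (f x - f x0) / (x - x0) by apply: ge_sup => //; exact: Sub.
  rewrite ler_pdivlMr ?subr_gt0//; nra.
Qed.

(** Integrate the supporting line of [f] at the mean of [X]. *)
Lemma jensen d (Omega : measurableType d) (P : probability Omega R) f
    (X : Omega -> R) : convex f ->
  P.-integrable setT (EFin \o X) -> P.-integrable setT (EFin \o (f \o X)) ->
  ((f (fine 'E_P[X]))%:E <= 'E_P[f \o X])%E.
Proof.
move=> cf iX ifX; set x0 := fine _.
have [k kf] := convex_supporting_line x0 cf.
have ic (c : R) : P.-integrable setT (EFin \o cst c) by apply: finite_measure_integrable_cst.
have ikX : P.-integrable setT (EFin \o (fun w => k * X w)).
  exact: (integrableZl measurableT k iX).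
have iL := integrable_EFinD (ic (f x0 - k * x0)) ikX.
have EkX : fine 'E_P[fun w => (k * X w)%R] = k * x0.
  rewrite unlock; under eq_integral do rewrite EFinM.
  by rewrite integralZl// fineM// /x0 ?unlock//; exact: integrable_fin_num.
have <- : fine 'E_P[fun w => (cst (f x0 - k * x0) w + k * X w)%R] = f x0.
  by rewrite (fine_expectationD (ic _) ikX) expectation_cst EkX/= subrK.
rewrite expectation_fineK//; rewrite unlock; apply: le_integral => // w _.
by rewrite lee_fin /cst /=; have := kf (X w); lra.
Qed.

Lemma jensen_concave d (Omega : measurableType d) (P : probability Omega R) f
    (X : Omega -> R) : concave f ->
  P.-integrable setT (EFin \o X) -> P.-integrable setT (EFin \o (f \o X)) ->
  ('E_P[f \o X] <= (f (fine 'E_P[X]))%:E)%E.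
Proof.
move=> cf iX ifX; have iNfX := integrableN ifX.
have := jensen cf iX iNfX; rewrite -(expectation_fineK iNfX) lee_fin.
have := fine_expectationD ifX iNfX; under [in LHS]eq_fun do rewrite subrr.
rewrite (expectation_cst P 0) -(expectation_fineK ifX) lee_fin /=; lra.
Qed.

End convexity.

Section loss.
Context {R : realType}.
Variables (T : R) (l : R -> R -> R) (l_loss : is_loss_function T l).
Variables (t : R) (t0T : t \in `[0, T]).

Lemma loss_measurable_section : measurable_fun setT (l t).
Proof.
have mDT : measurable ([set` `[0, T]] `*` [set: R]) by exact: measurableX.
apply: (@measurable_comp _ _ _ _ _ _ ([set` `[0, T]] `*` setT)
  (fun p : R * R => l p.1 p.2) setT (pair t)) => //.
  by move=> _ [x _ <-].
exact: loss_measurable l_loss.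
Qed.

Lemma loss_integrable d (Omega : measurableType d) (P : probability Omega R)
    (X : Omega -> R) : P.-integrable setT (EFin \o X) ->
  P.-integrable setT (EFin \o (fun w => l t (X w))).
Proof.
move=> iX; have [c [C [c0 cC lip]]] := loss_bilipschitz l_loss.
have mX : measurable_fun setT X by apply/measurable_EFinP; exact: measurable_int iX.
have i1 : P.-integrable setT (EFin \o cst `|l t 0|).
  by apply: finite_measure_integrable_cst.
have i2 := integrableZl measurableT C (integrable_norm iX).
apply: le_integrable (integrableD measurableT i1 i2) => //.
  by apply/measurable_EFinP; apply: measurableT_comp => //; exact: loss_measurable_section.
move=> w _; rewrite /= lee_fin [leRHS]ger0_norm; last first.
  by rewrite addr_ge0// mulr_ge0//; lra.
have /andP[_] := lip t (X w) 0 t0T; rewrite subr0 => lX.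
rewrite -[X in `|X|](subrK (l t 0)) (le_trans (ler_normD _ _))// addrC.
exact: lerD.
Qed.

Lemma loss_mono x y : x <= y -> l t x <= l t y.
Proof.
rewrite le_eqVlt => /predU1P[->//|/(loss_increasing l_loss t0T)]; exact: ltW.
Qed.

End loss.

Lemma loss_expansive (R : realType) (T : R) (l : R -> R -> R) :
  is_loss_function T l -> exists2 c : R, 0 < c &
  forall t x y, t \in `[0, T] -> x <= y -> c * (y - x) <= l t y - l t x.
Proof.
move=> l_loss; have [c [C [c0 cC lip]]] := loss_bilipschitz l_loss.
exists c => // t x y t0T xy; have /andP[+ _] := lip t y x t0T.
have lxy := loss_mono l_loss t0T xy.
by rewrite !ger0_norm ?subr_ge0.
Qed.

(** As long as the mean of [Y2] dominates that of [Y1], its excess bounds from below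
    the expected loss of [Y2]: this is the chain of inequalities of the
    introduction, with the strict monotonicity of the loss made quantitative. *)
Lemma constraint_slack (R : realType) d (Omega : measurableType d)
    (P : probability Omega R) (T : R) (l1 l2 : R -> R -> R) :
  is_loss_function T l1 -> is_loss_function T l2 ->
  exists2 c : R, 0 < c & forall t (Y1 Y2 : Omega -> R), t \in `[0, T] ->
    concave (l1 t) -> convex (l2 t) -> (forall x, l1 t x <= l2 t x) ->
    P.-integrable setT (EFin \o Y1) -> P.-integrable setT (EFin \o Y2) ->
    (0 <= 'E_P[fun w => l1 t (Y1 w)])%E ->
    fine 'E_P[Y1] <= fine 'E_P[Y2] ->
    ((c * (fine 'E_P[Y2] - fine 'E_P[Y1]))%:E <= 'E_P[fun w => l2 t (Y2 w)])%E.
Proof.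
move=> l1_loss l2_loss; have [c c0 l2_exp] := loss_expansive l2_loss.
exists c => // t Y1 Y2 t0T l1_concave l2_convex l12 iY1 iY2 l1Y1 m12.
have := jensen l2_convex iY2 (loss_integrable l2_loss t0T iY2).
apply: le_trans; rewrite lee_fin.
have l1m1 : 0 <= l1 t (fine 'E_P[Y1]).
  rewrite -lee_fin; apply: le_trans l1Y1 _.
  exact: jensen_concave l1_concave iY1 (loss_integrable l1_loss t0T iY1).
by have := l2_exp t _ _ t0T m12; have := l12 (fine 'E_P[Y1]); lra.
Qed.

(** * Comparison of the means *)

Section backward_comparison.
Context {R : realType}.

Lemma within_continuous_eps (A : set R) (f : R -> R) x :
  {within A, continuous f} -> A x ->
  forall e, 0 < e -> exists2 r, 0 < r &
    forall y, A y -> `|x - y| < r -> `|f x - f y| < e.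
Proof.
move=> /subspace_continuousP cf Ax e e0.
have /cvgrPdist_lt/(_ e e0) := cf x Ax.
rewrite near_withinE => -[r /= r0 rf]; exists r => // y Ay xy.
exact: rf.
Qed.

(** Let [D] be positive at [t0] and let [t1] be its next zero. On a short interval
    ending at [t1], the increment bound between the point where [D] is maximal
    and times close to [t1] shows that [D] keeps at least half of its maximum up
    to [t1], contradicting continuity there. *)
Lemma backward_comparison (T M : R) (D : R -> R) : 0 <= M ->
  {within [set` `[0, T]], continuous D} -> D T <= 0 ->
  (forall s t b, 0 <= s -> s <= t -> t <= T ->
    (forall r, s <= r -> r <= t -> 0 < D r /\ D r <= b) ->
    D s - D t <= M * b * (t - s)) ->
  forall t, t \in `[0, T] -> D t <= 0.
Proof.
move=> M0 cD DT0 decr t0; rewrite in_itv/= => /andP[t00 t0T].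
rewrite leNgt; apply/negP => Dt0.
pose S := [set t | t0 <= t <= T /\ D t <= 0].
have S0 : S !=set0 by exists T; split; rewrite ?t0T ?lexx.
have Slb : has_lbound S by exists t0 => t [/andP[]].
pose t1 := inf S.
have t01 : t0 <= t1 by apply: lb_le_inf => // t [/andP[]].
have t1T : t1 <= T by apply: ge_inf => //; split; rewrite ?t0T ?lexx.
have in0T t : t0 <= t -> t <= T -> [set` `[0, T]] t.
  by move=> t0t tT; rewrite /= in_itv/= tT (le_trans t00).
have Dt1 : D t1 <= 0.
  rewrite leNgt; apply/negP => Dt1.
  have [r r0 rD] := within_continuous_eps cD (in0T _ t01 t1T) Dt1.
  have [t [/andP[t0t tT] Dt] tr] := inf_adherent r0 (conj S0 Slb).
  have t1t : t1 <= t by apply: ge_inf => //; split => //; exact/andP.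
  have := rD t (in0T _ t0t tT); rewrite -/t1 in tr.
  have -> : `|t1 - t| < r by rewrite distrC ger0_norm ?subr_ge0// ltrBlDl.
  by move=> /(_ isT); rewrite ltr_norml => /andP[_]; lra.
have Dpos t : t0 <= t -> t < t1 -> 0 < D t.
  move=> t0t tt1; rewrite ltNge; apply/negP => Dt.
  have : t1 <= t by apply: ge_inf => //; split => //; rewrite t0t (le_trans (ltW tt1)).
  by rewrite leNgt tt1.
have t0lt1 : t0 < t1.
  by rewrite lt_neqAle t01 andbT; apply/eqP => e; move: Dt0; rewrite e ltNge Dt1.
(* over a time of length dl the increment bound is at most half of the maximum *)
pose dl := (2 * (M + 1))^-1.
have dl0 : 0 < dl by rewrite invr_gt0; lra.
have Mdl : M * dl <= 2^-1.
  by rewrite /dl ler_pdivrMr; lra.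
pose s := Num.max t0 (t1 - dl).
have t0s : t0 <= s by rewrite le_max lexx.
have st1 : s < t1 by rewrite gt_max t0lt1/=; lra.
have s1dl : t1 - dl <= s by rewrite le_max lexx orbT.
have cDs : {within `[s, t1], continuous D}.
  apply: continuous_subspaceW cD => t /=; rewrite !in_itv/= => /andP[st tt1].
  by rewrite (le_trans t00 (le_trans t0s st)) (le_trans tt1).
have [c] := EVT_max (ltW st1) cDs.
rewrite in_itv/= => /andP[sc ct1] cmax.
have Dc : 0 < D c.
  apply: lt_le_trans (cmax s _); first exact: Dpos.
  by rewrite in_itv/= lexx ltW.
have ct1' : c < t1.
  by rewrite lt_neqAle ct1 andbT; apply/eqP => e; move: Dc; rewrite e ltNge Dt1.
have Dc2 : 0 < D c / 2 by lra.
have [r r0 rD] := within_continuous_eps cD (in0T _ t01 t1T) Dc2.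
pose t := Num.max c (t1 - r / 2).
have ct : c <= t by rewrite le_max lexx.
have tt1 : t < t1 by rewrite gt_max ct1'/=; lra.
have t1r : t1 - r / 2 <= t by rewrite le_max lexx orbT.
have : D c - D t <= M * D c * (t - c).
  apply: decr => //.
  - exact: le_trans t00 (le_trans t0s sc).
  - exact: le_trans (ltW tt1) t1T.
  - move=> u cu ut; split.
      by apply: Dpos; [exact: le_trans t0s (le_trans sc cu)|exact: le_lt_trans tt1].
    by apply: cmax; rewrite in_itv/= (le_trans sc cu) (le_trans ut)// ltW.
have : M * D c * (t - c) <= D c / 2.
  have -> : M * D c * (t - c) = D c * (M * (t - c)) by ring.
  rewrite ler_pM2l//; apply: le_trans Mdl; rewrite ler_wpM2l//; lra.
have : `|D t1 - D t| < D c / 2.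
  apply: rD; first by apply: in0T; [exact: le_trans t0s (le_trans sc ct)|exact: le_trans (ltW tt1) t1T].
  by rewrite ger0_norm; lra.
by rewrite ltr_norml => /andP[h1 h2]; lra.
Qed.

End backward_comparison.

(** Where [g] is at least [e], its integral is at least [e] times the increment
    of [K]. *)
Lemma skorokhod_flat (R : realType) (T : R) (K : I0T T) (g : R -> \bar R) (s t e : R) :
  (\int[lebesgue_stieltjes_measure (extend_const K)]_(r in [set` `[0%R, T]]) g r = 0)%E ->
  (forall r, r \in `[0, T] -> (0 <= g r)%E) ->
  0 <= s -> s <= t -> t <= T -> 0 < e ->
  (forall r, s <= r -> r <= t -> (e%:E <= g r)%E) ->
  K t = K s.
Proof.
move=> g0 gge0 s0 st tT e0 eg.
set nu := lebesgue_stieltjes_measure (extend_const K) in g0 *.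
have stD : `]s, t] `<=` [set` `[0, T]].
  move=> r /=; rewrite !in_itv/= => /andP[sr rt].
  by rewrite (le_trans s0 (ltW sr)) (le_trans rt).
have nust : nu `]s, t]%classic = (K t - K s)%:E.
  rewrite /nu /lebesgue_stieltjes_measure /measure_extension.
  rewrite measurable_mu_extE/=; last exact: is_ocitv.
  rewrite wlength_itv_bnd// /extend_const.
  rewrite !(min_idPl _) ?(le_trans st)//.
  by rewrite !(max_idPr _) ?(le_trans s0).
have : (\int[nu]_(r in `]s, t]) e%:E <= 0)%E.
  rewrite -g0 -(setIidr stD) integral_mkcondr; apply: ge0_le_lower_integral => r rD.
    by rewrite patchE; case: ifP => // _; rewrite lee_fin ltW.
  rewrite patchE; case: ifPn => [/set_mem/=|_]; last exact: gge0.
  by rewrite in_itv/= => /andP[sr rt]; apply: eg => //; exact: ltW.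
have -> : (\int[nu]_(r in `]s, t]) e%:E = e%:E * nu `]s, t]%classic)%E.
  exact: integral_cst.
rewrite nust -EFinM lee_fin pmulr_rle0// subr_le0 => Kts.
apply/eqP; rewrite eq_le Kts/=; apply: I0T_nondecreasing => //; rewrite in_itv/=.
  by rewrite s0 (le_trans st).
by rewrite tT (le_trans s0).
Qed.

Lemma Rintegral_drift_le (R : realType) (a u v : R -> R) (M b s t : R) :
  s <= t ->
  lebesgue_measure.-integrable `]s, t] (fun r => (a r * u r)%:E) ->
  lebesgue_measure.-integrable `]s, t] (fun r => (a r * v r)%:E) ->
  (forall r, r \in `]s, t] -> `|a r| <= M /\ 0 <= v r - u r <= b) ->
  \int[lebesgue_measure]_(r in `]s, t]) (a r * v r) -
    \int[lebesgue_measure]_(r in `]s, t]) (a r * u r) <= M * b * (t - s).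
Proof.
set mu := @lebesgue_measure R => st iu iv aMb.
have mst : measurable (`]s, t]%classic : set R) by exact: measurable_itv.
rewrite -(@RintegralB _ _ _ mu _ (fun r => a r * v r) (fun r => a r * u r) mst iv iu).
have <- : (\int[mu]_(r in `]s, t]) (M * b) = M * b * (t - s)).
  rewrite Rintegral_cst//= lebesgue_measure_itv/= lte_fin.
  by case: ltP => //= ts; rewrite (_ : t - s = 0)//; lra.
apply: (@le_Rintegral _ _ _ mu _ _ _ mst).
- exact: (@integrableB _ _ _ mu _ mst _ _ iv iu).
- apply/integrableP; split; first exact: measurable_cst.
  rewrite integral_cst//= lebesgue_measure_itv/= lte_fin.
  by case: ifP => _; rewrite -?EFinB -?EFinM ?mule0 ltry.
move=> r rst; have [ar /andP[uv0 uvb]] := aMb r rst.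
rewrite -mulrBr; apply: (@le_trans _ _ (`|a r| * (v r - u r))).
  by rewrite ler_wpM2r ?ler_norm.
exact: ler_pM.
Qed.

Theorem corollary3p18 (R : realType) (d : measure_display)
    (Omega : measurableType d) (P : probability Omega R) (T : R) (T_gt0 : 0 < T)
    (F : R -> set (set Omega)) (B : R -> Omega -> R)
    (F_filtration : is_filtration T F)
    (F_usual : usual_conditions P T F)
    (B_brownian : is_brownian_motion P T F B)
    (F_augmented : forall t, t \in `[0, T] -> F t = augmented_filtration P B t)
    (l1 l2 : R -> R -> R)
    (l1_loss : is_loss_function T l1) (l2_loss : is_loss_function T l2)
    (a : R -> R) (a_measurable : measurable_fun [set` `[0, T]] a)
    (a_bounded : exists M : R, forall t, t \in `[0, T] -> `|a t| <= M)
    (f1 f2 : R -> Omega -> R) (f1_H2 : H2_process P T F f1) (f2_H2 : H2_process P T F f2)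
    (xi1 xi2 : Omega -> R) (xi1_L2 : L2_terminal P T F xi1) (xi2_L2 : L2_terminal P T F xi2)
    (xi1_loss : (0 <= 'E_P[fun w => l1 T (xi1 w)])%E)
    (xi2_loss : (0 <= 'E_P[fun w => l2 T (xi2 w)])%E)
    (Y1 Z1 : R -> Omega -> R) (K1 : I0T T)
    (sol1 : mean_reflected_solution P F B l1 a f1 xi1 Y1 Z1 K1)
    (Y2 Z2 : R -> Omega -> R) (K2 : I0T T)
    (sol2 : mean_reflected_solution P F B l2 a f2 xi2 Y2 Z2 K2)
    (xi_le : ('E_P[xi2] <= 'E_P[xi1])%E)
    (f_le : forall t, t \in `[0, T] -> ('E_P[f2 t] <= 'E_P[f1 t])%E)
    (l1_concave : forall t, t \in `[0, T] -> concave (l1 t))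
    (l2_convex : forall t, t \in `[0, T] -> convex (l2 t))
    (l_le : forall t x, t \in `[0, T] -> l1 t x <= l2 t x) :
  forall t, t \in `[0, T] -> ('E_P[Y2 t] <= 'E_P[Y1 t])%E.
Proof.
have lin (x y p1 p2 k e : R) : x - y <= e -> p2 <= p1 -> 0 <= k ->
    x + p2 - (y + p1 + k) <= e by lra.
have [M aM] := a_bounded.
have M0 : 0 <= M by apply: le_trans (aM 0 _); rewrite // in_itv/= lexx ltW.
pose mu := @lebesgue_measure R.
pose m1 t := fine 'E_P[Y1 t]; pose m2 t := fine 'E_P[Y2 t].
have iY1 t (tT : t \in `[0, T]) := S2_integrable T_gt0 F_filtration (sol_Y sol1) tT.
have iY2 t (tT : t \in `[0, T]) := S2_integrable T_gt0 F_filtration (sol_Y sol2) tT.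
suff m21 : forall t, t \in `[0, T] -> m2 t - m1 t <= 0.
  move=> t t0T; rewrite -(expectation_fineK (iY1 _ t0T)) -(expectation_fineK (iY2 _ t0T)).
  by rewrite lee_fin -subr_le0; exact: m21.
have terminal1 := mean_terminal T_gt0 F_filtration B_brownian a_measurable aM f1_H2 xi1_L2 sol1.
have terminal2 := mean_terminal T_gt0 F_filtration B_brownian a_measurable aM f2_H2 xi2_L2 sol2.
have cont1 := mean_continuous T_gt0 F_filtration B_brownian a_measurable aM f1_H2 xi1_L2 sol1.
have cont2 := mean_continuous T_gt0 F_filtration B_brownian a_measurable aM f2_H2 xi2_L2 sol2.
have incr1 := mean_increment T_gt0 F_filtration B_brownian a_measurable aM f1_H2 xi1_L2 sol1.
have incr2 := mean_increment T_gt0 F_filtration B_brownian a_measurable aM f2_H2 xi2_L2 sol2.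
have [am1 Ef1 _] := mean_equation T_gt0 F_filtration B_brownian a_measurable aM f1_H2 xi1_L2 sol1.
have [am2 Ef2 _] := mean_equation T_gt0 F_filtration B_brownian a_measurable aM f2_H2 xi2_L2 sol2.
have [c c0 slack] := constraint_slack P l1_loss l2_loss.
have l2_gap r : r \in `[0, T] -> m1 r <= m2 r ->
    ((c * (m2 r - m1 r))%:E <= 'E_P[fun w => l2 r (Y2 r w)])%E.
  move=> rT; apply: slack (rT) _ _ _ (iY1 r rT) (iY2 r rT) _.
  - exact: l1_concave.
  - exact: l2_convex.
  - by move=> x; exact: l_le.
  - exact: sol_constraint sol1 _ rT.
have cD : {within [set` `[0, T]], continuous (fun r => m2 r - m1 r)}.
  by move=> r; apply: cvgB; [exact: cont2|exact: cont1].
apply: (@backward_comparison _ T M (fun r => m2 r - m1 r)) => //.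
- rewrite subr_le0 /m1 /m2 terminal1 terminal2.
  by rewrite -lee_fin !expectation_fineK//; exact: (L2_terminal_integrable T_gt0 F_filtration).
move=> s t b s0 st tT mb.
have in0T r : s <= r -> r <= t -> r \in `[0, T].
  by move=> sr rt; rewrite in_itv/= (le_trans s0 sr) (le_trans rt tT).
(* m2 - m1 has a positive minimum on [s, t], so the slack of the constraint on Y2
   is bounded away from 0 there *)
have K2st : K2 t = K2 s.
  have cst_ : {within `[s, t], continuous (fun r => m2 r - m1 r)}.
    apply: continuous_subspaceW cD => r /=.
    by rewrite [r \in `[s, t]]in_itv/= => /andP[sr rt]; exact: in0T.
  have [r] := EVT_min st cst_.
  rewrite in_itv/= => /andP[sr rt] rmin.
  have [mr _] := mb r sr rt.
  apply: (skorokhod_flat (sol_skorokhod sol2) _ s0 st tT (mulr_gt0 c0 mr)).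
    by move=> u uT; exact: sol_constraint sol2 _ uT.
  move=> u su ut; have uT := in0T u su ut.
  have mru : m2 r - m1 r <= m2 u - m1 u by apply: rmin; rewrite in_itv/= su.
  apply: le_trans (l2_gap u uT _); last by lra.
  by rewrite lee_fin ler_pM2l.
have K1st : K1 s <= K1 t.
  by apply: I0T_nondecreasing => //; apply: in0T.
have := incr1 s t s0 st tT; have := incr2 s t s0 st tT.
rewrite -/(m1 s) -/(m1 t) -/(m2 s) -/(m2 t) K2st subrr addr0 => e2 e1.
have -> : m2 s - m1 s - (m2 t - m1 t) = (m2 s - m2 t) - (m1 s - m1 t) by ring.
rewrite e1 e2.
set Phi2 := fine _; set Phi1 := fine _.
have stD : `]s, t] `<=` [set` `[0, T]].
  by move=> r /=; rewrite in_itv/= => /andP[sr rt]; apply: in0T => //; exact: ltW.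
have mst : measurable (`]s, t]%classic : set R) by exact: measurable_itv.
have mD : measurable ([set` `[0, T]] : set R) by exact: measurable_itv.
have Ef1st := @integrableS _ _ _ mu _ _ _ mD mst stD Ef1.
have Ef2st := @integrableS _ _ _ mu _ _ _ mD mst stD Ef2.
have am1st := @integrableS _ _ _ mu _ _ _ mD mst stD am1.
have am2st := @integrableS _ _ _ mu _ _ _ mD mst stD am2.
have Phi21 : Phi2 <= Phi1.
  apply: fine_le; try exact: (@integrable_fin_num _ _ _ mu _ mst).
  by apply: (@le_integral _ _ _ mu _ mst) => // r /set_mem rst; apply: f_le; exact: stD rst.
have drift21 : \int[mu]_(r in `]s, t]) (a r * m2 r) -
    \int[mu]_(r in `]s, t]) (a r * m1 r) <= M * b * (t - s).
  apply: Rintegral_drift_le => // r; rewrite in_itv/= => /andP[/ltW sr rt].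
  split; first by apply: aM; exact: in0T.
  by have [mr0 mrb] := mb r sr rt; rewrite mrb ltW.
by apply: lin => //; rewrite subr_ge0.
Qed.
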